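(* There exist absolute constants $c,C>0$ and, for each sufficiently large $m\in\mathbb{N}$, a point configuration $\{p_j\}_{j=1}^m\subset\mathbb{S}$ (the dependence of $p_j$ on $m$ being suppressed), such that the resulting family satisfies the following properties. (S) For all $j\ne k$, $\operatorname{dist}(p_j,p_k)\ge\frac{c}{\sqrt m}$. (E) For any $f\in C^\infty(\mathbb{S})$, $\displaystyle\lim_{m\to\infty}\frac1m\sum_{j=1}^mf(p_j)=\frac1{4\pi}\int_{\mathbb{S}}f(x)\,dx$. (G) For all great circles $G\subset\mathbb{S}$, $$\#\left\{j:p_j\in\mathcal{N}_{m^{-1}}(G)\right\}\le\frac{C\log m}{\log\log m}.$$
   Context: $\mathbb{S}\subset\mathbb{R}^3$ is the two-dimensional unit sphere with the round metric, $\operatorname{dist}$ is geodesic distance, $dx$ is area measure (total mass $4\pi$), and $\mathcal{N}_r(\Omega)=\{x\in\mathbb{S}:\operatorname{dist}(\Omega,x)\le r\}$ denotes the $r$-neighborhood of $\Omega\subset\mathbb{S}$. *)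

(* Defs.v *)
From HB Require Import structures.
From mathcomp Require Import all_boot all_order all_algebra.
From mathcomp Require Import all_classical all_reals all_analysis.

Set Implicit Arguments.
Unset Strict Implicit.
Unset Printing Implicit Defensive.

Import Order.TTheory GRing.Theory Num.Theory.
Import numFieldTopology.Exports numFieldNormedType.Exports.

Local Open Scope classical_set_scope.
Local Open Scope ring_scope.

(* R^3 is 'rV[R]_3.  The library norm on 'rV[R]_3 is the sup norm: it is used
   below only through the topology it induces, and all metric notions on the
   sphere go through the Euclidean inner product. *)
Definition dot (R : realType) (x y : 'rV[R]_3) : R :=
  \sum_(i < 3) x 0 i * y 0 i.

Definition sphere (R : realType) : set 'rV[R]_3 := [set x | dot x x = 1].

(* Geodesic distance of the round metric: the angle between two unit vectors. *)
Definition gdist (R : realType) (x y : 'rV[R]_3) : R := acos (dot x y).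

(* The infimum is taken in the extended reals, so that the distance to the
   empty set is +oo. *)
Definition gdist_set (R : realType) (A : set 'rV[R]_3) (x : 'rV[R]_3) : \bar R :=
  ereal_inf [set (gdist a x)%:E | a in A].

Definition neighborhood (R : realType) (r : R) (A : set 'rV[R]_3) :
    set 'rV[R]_3 :=
  [set x | sphere x /\ (gdist_set A x <= r%:E)%E].

(* Intersections of the sphere with a plane through the origin, the plane
   being given by a unit normal. *)
Definition great_circle (R : realType) (G : set 'rV[R]_3) : Prop :=
  exists2 w : 'rV[R]_3, sphere w & G = [set x | sphere x /\ dot x w = 0].

(* Spherical coordinates: colatitude z.1 and longitude z.2. *)
Definition spherical (R : realType) (z : R * R) : 'rV[R]_3 :=
  \row_(i < 3) [:: sin z.1 * cos z.2; sin z.1 * sin z.2; cos z.1]`_i.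

(* Integral against the area measure.  In spherical coordinates the round
   metric is d(z.1)^2 + (sin z.1)^2 d(z.2)^2, so its area element is
   sin z.1 d(z.1) d(z.2). *)
Definition sphere_integral (R : realType) (f : 'rV[R]_3 -> R) : R :=
  \int[(@lebesgue_measure R \x @lebesgue_measure R)%E]_(z in
      `[0, pi] `*` `[0, pi *+ 2]) (f (spherical z) * sin z.1).

Definition unit_vector (R : realType) (i : 'I_3) : 'rV[R]_3 := delta_mx 0 i.

(* F is C^k on the open set U: the partial derivatives of F of order at most k
   exist and are continuous on U. *)
Fixpoint Ck_on (R : realType) (k : nat) (U : set 'rV[R]_3)
    (F : 'rV[R]_3 -> R) : Prop :=
  (forall x, U x -> {for x, continuous F}) /\
  match k with
  | 0 => True
  | k'.+1 => forall i : 'I_3,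
      (forall x, U x -> derivable F x (unit_vector R i)) /\
      Ck_on k' U ('D_(unit_vector R i) F)
  end.

Definition smooth_on (R : realType) (U : set 'rV[R]_3) (F : 'rV[R]_3 -> R) :
    Prop :=
  forall k, Ck_on k U F.

(* Functions on the sphere are represented by functions on R^3, of which only
   the values on the sphere matter; f is in C^oo(sphere) when near every point
   of the sphere it is the restriction of a C^oo function of R^3. *)
Definition smooth_on_sphere (R : realType) (f : 'rV[R]_3 -> R) : Prop :=
  forall x, sphere x -> exists U : set 'rV[R]_3, exists F : 'rV[R]_3 -> R,
    [/\ open U, U x, smooth_on U F & forall y, U y -> sphere y -> F y = f y].

(* Main.v *)
Require Import Defs.
From HB Require Import structures.
From mathcomp Require Import all_boot all_order all_algebra.
From mathcomp Require Import all_classical all_reals all_analysis.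
From mathcomp Require Import measurable_realfun.
From mathcomp Require Import ring lra zify.

Import Order.TTheory GRing.Theory Num.Theory.
Import numFieldTopology.Exports numFieldNormedType.Exports.

Local Open Scope classical_set_scope.
Local Open Scope ring_scope.

(* Cut the sphere into K^2 cells of equal area, where K tends to infinity with m
   but K^4 <= log m, and spread the m points evenly over the cells; this gives
   equidistribution.  In each cell the points are placed on a grid of mesh about
   1/sqrt m, and each of them is moved independently and at random by less than
   half a mesh, which preserves the separation.  A slab of width 1/m around a
   great circle crosses about sqrt m of the squares of a given cell and fills
   a proportion 1/sqrt m of each, so that it contains O(1) points of the cell, and
   O(K^2) points in all, on average.  The numbers of points in the slab being sums
   of independent indicators, the average of t^(number of points) is at most
   exp(t O(K^2)); for t = log m / K^2 this is a power of m.  Some choice works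
   for a net of m^O(1) slabs simultaneously, and then the number of points in each
   slab is O(log m / log t) = O(log m / log log m). *)

(** * Trigonometry and distances on the sphere *)

(** An undisplaced grid may have a whole line of points inside one slab, hence the random
    displacements. They range over the finite set of pairs [(e, g)] with [e, g < m], so that every
    average is a finite count. Their step [mesh / (2 m)], of order m^(-3/2), is finer than the slab
    by a factor sqrt m: a slab crossing a line of displaced positions transversally catches O(sqrt
    m) of them. A slot has O(sqrt m) parallel grid lines, each in m displaced versions, hence O(m^2)
    bad pairs (index, displacement) against m^2 displacements of one index, that is O(1) bad points
    on average. The obstacle is a slab that runs along the lines. Over a narrow sector, however, it
    is transverse either to all meridians or to all parallels, and the count is made along that
    family. The grid fills only a part of its cell. Equidistribution is not affected, since it only
    sees how many points each of the shrinking cells holds, and the empty margins keep different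
    cells apart and the points away from the poles. *)

Section trig.
Context {R : realType}.
Implicit Types x y : R.

Lemma sin_le x : 0 <= x -> sin x <= x.
Proof.
move=> x0.
have [|c] := @MVT_segment R sin cos 0 x x0 (fun y _ => is_derive_sin y).
- by apply: continuous_subspaceT; exact: continuous_sin.
by move=> _; rewrite sin0 !subr0 => ->; rewrite ler_piMl// cos_le1.
Qed.

Lemma normr_sin_le x : `|sin x| <= `|x|.
Proof.
wlog x0 : x / 0 <= x.
  move=> wl; have [/wl//|x0] := leP 0 x.
  by rewrite -(normrN x) -(normrN (sin x)) -sinN; apply: wl; lra.
rewrite (ger0_norm x0) ler_norml sin_le// andbT.
have [|c] := @MVT_segment R sin cos 0 x x0 (fun y _ => is_derive_sin y).
- by apply: continuous_subspaceT; exact: continuous_sin.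
by move=> _; rewrite sin0 !subr0 => ->; rewrite -mulN1r ler_wpM2r// cos_geN1.
Qed.

Lemma sqr_sin_le x : sin x ^+ 2 <= x ^+ 2.
Proof. by rewrite -(real_normK (num_real (sin x))) -(real_normK (num_real x)) lerXn2r ?nnegrE// normr_sin_le. Qed.

Lemma one_sub_cos x : 1 - cos x = 2 * sin (x / 2) ^+ 2.
Proof.
have {1}-> : x = (x / 2) *+ 2 by lra.
by rewrite cos_mulr2n; have := cos2Dsin2 (x / 2); lra.
Qed.

Lemma cos_ge x : 1 - x ^+ 2 / 2 <= cos x.
Proof.
have := one_sub_cos x; have := sqr_sin_le (x / 2); rewrite exprMn.
by set y := x ^+ 2; lra.
Qed.

Lemma sin_ge x : 0 <= x <= 1 -> x / 2 <= sin x.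
Proof.
move=> /andP[x0 x1].
have [|c /itvP ci] := @MVT_segment R sin cos 0 x x0 (fun y _ => is_derive_sin y).
- by apply: continuous_subspaceT; exact: continuous_sin.
rewrite sin0 !subr0 => ->; rewrite mulrC ler_wpM2r//.
have c0 : 0 <= c by rewrite ci.
have c1 : c <= 1 by rewrite (le_trans _ x1)// ci.
by have := cos_ge c; nra.
Qed.

Lemma normr_sin_ge x : `|x| <= 1 -> `|x| / 2 <= `|sin x|.
Proof.
wlog x0 : x / 0 <= x.
  move=> wl; have [/wl//|x0] := leP 0 x.
  by rewrite -(normrN x) -(normrN (sin x)) -sinN; apply: wl; lra.
rewrite (ger0_norm x0) => x1; rewrite (le_trans _ (ler_norm _))// sin_ge//.
by rewrite x0.
Qed.

Lemma pi_le4 : pi <= 4 :> R.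
Proof. by have := pihalf_lt2 R; lra. Qed.

Lemma sin_ge_margin (e y : R) : 0 <= e <= 1 -> e <= y <= pi - e -> e / 2 <= sin y.
Proof.
wlog yp : y / y <= pi / 2.
  move=> wl e01 ey; have [/wl|yp] := leP y (pi / 2); first exact.
  have -> : sin y = sin (pi - y).
    by rewrite sinB sinpi cospi; lra.
  by apply: wl => //; lra.
move=> /andP[e0 e1] /andP[ey _].
apply: le_trans (sin_ge e _) _; first by rewrite e0.
have [<-//|ne] := eqVneq e y.
apply: ltW; rewrite ltr_sin ?in_itv/=; [by rewrite lt_neqAle ne | |];
  have := pi_ge0 R; lra.
Qed.

Lemma dotE (x y : 'rV[R]_3) :
  dot x y = x 0 0 * y 0 0 + x 0 1 * y 0 1 + x 0 2%:R * y 0 2%:R.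
Proof.
rewrite /dot !big_ord_recl big_ord0 addr0 addrA.
by congr (_ * _ + _ * _ + _ * _); congr (_ _ _); apply/val_inj.
Qed.

Lemma dot_spherical (w : 'rV[R]_3) (a b : R) :
  dot (spherical (a, b)) w = (w 0 0 * cos b + w 0 1 * sin b) * sin a + w 0 2%:R * cos a.
Proof. by rewrite dotE !mxE/=; ring. Qed.

Lemma spherical_sphere (z : R * R) : sphere (spherical z).
Proof.
rewrite /sphere/= dotE !mxE/=.
have := cos2Dsin2 z.1; have := cos2Dsin2 z.2; set a := cos z.1; set b := cos z.2.
set a' := sin z.1; set b' := sin z.2 => H1 H2.
transitivity (a' ^+ 2 * (b ^+ 2 + b' ^+ 2) + a ^+ 2); first ring.
by rewrite H1 mulr1 addrC.
Qed.

(** This is the haversine formula. For colatitudes in [0, pi] the differences of colatitude and of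
    longitude both lower the product, so either of them alone suffices to separate two points. *)
Lemma dot_spherical2 (a b a' b' : R) :
  dot (spherical (a, b)) (spherical (a', b')) =
  cos (a - a') - sin a * sin a' * (1 - cos (b - b')).
Proof. by rewrite dot_spherical !mxE/= !cosB; ring. Qed.

Lemma sqr_sub_sphere (x y : 'rV[R]_3) : sphere x -> sphere y ->
  dot (x - y) (x - y) = 2 - 2 * dot x y.
Proof.
rewrite /sphere/= !dotE !mxE => hx hy.
transitivity ((x 0 0 * x 0 0 + x 0 1 * x 0 1 + x 0 2%:R * x 0 2%:R) +
  (y 0 0 * y 0 0 + y 0 1 * y 0 1 + y 0 2%:R * y 0 2%:R)
  - 2 * (x 0 0 * y 0 0 + x 0 1 * y 0 1 + x 0 2%:R * y 0 2%:R)); first ring.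
by rewrite hx hy; ring.
Qed.

Lemma dot_bounds (x y : 'rV[R]_3) : sphere x -> sphere y -> -1 <= dot x y <= 1.
Proof.
move=> hx hy.
have dot_ge0 z : 0 <= dot z z :> R by rewrite dotE -!expr2; rewrite !addr_ge0// sqr_ge0.
have hy' : sphere (- y) by rewrite /sphere/= dotE !mxE !mulrNN -dotE.
have := dot_ge0 (x - y); have := dot_ge0 (x - - y).
rewrite !sqr_sub_sphere//.
have -> : dot x (- y) = - dot x y by rewrite !dotE !mxE; ring.
by lra.
Qed.

Lemma gdist_ge (r : R) (x y : 'rV[R]_3) : sphere x -> sphere y ->
  dot x y <= 1 - r ^+ 2 / 2 -> r <= gdist x y.
Proof.
move=> hx hy d; rewrite leNgt; apply/negP => lt.
have b := dot_bounds x y hx hy.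
have g0 : 0 <= gdist x y by apply: acos_ge0.
have := cos_ge (gdist x y); rewrite /gdist acosK ?in_itv//= -/(gdist x y).
by nra.
Qed.

Lemma sqr_gdist_ge (x y : 'rV[R]_3) : sphere x -> sphere y ->
  2 - 2 * dot x y <= gdist x y ^+ 2.
Proof.
move=> hx hy; have b := dot_bounds x y hx hy.
have := cos_ge (gdist x y); rewrite {2}/gdist acosK ?in_itv//=.
by lra.
Qed.

(** Lagrange's identity: the defect is the squared length of the cross product. *)
Lemma dot_cauchy (x y : 'rV[R]_3) : dot x y ^+ 2 <= dot x x * dot y y.
Proof.
rewrite -subr_ge0 !dotE.
rewrite [leRHS](_ : _ = (x 0 0 * y 0 1 - x 0 1 * y 0 0) ^+ 2 +
   (x 0 0 * y 0 2%:R - x 0 2%:R * y 0 0) ^+ 2 +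
   (x 0 1 * y 0 2%:R - x 0 2%:R * y 0 1) ^+ 2); last ring.
by rewrite !addr_ge0// sqr_ge0.
Qed.

(** For [a] on the circle, [dot x w] is up to sign [dot (a - x) w], which is at most the chord and
    hence at most the arc from [a] to [x]. The factor 2 leaves room to pick [a] without showing that
    the infimum is attained. *)
Lemma neighborhood_dot (r : R) (w x : 'rV[R]_3) : 0 < r -> sphere w ->
  neighborhood r [set x | sphere x /\ dot x w = 0] x -> `|dot x w| <= 2 * r.
Proof.
move=> r0 hw [hx]; rewrite /gdist_set => le.
have : (ereal_inf [set (gdist a x)%:E | a in [set x | sphere x /\ dot x w = 0%R]] < (2 * r)%:E)%E.
  by rewrite (le_lt_trans le)// lte_fin; lra.
move=> /ereal_inf_lt[_ /= [a [ha aw] <-]]; rewrite lte_fin => ltr.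
have ax := sqr_gdist_ge _ _ ha hx.
have g0 : 0 <= gdist a x by apply: acos_ge0; apply: dot_bounds.
have : dot x w ^+ 2 <= gdist a x ^+ 2.
  apply: le_trans ax.
  have -> : dot x w = - dot (a - x) w.
    by move: aw; rewrite !dotE !mxE; lra.
  rewrite sqrrN (le_trans (dot_cauchy _ _))//.
  by rewrite sqr_sub_sphere// hw mulr1.
rewrite -(real_normK (num_real (dot x w))) ler_pXn2r ?nnegrE// => h.
by rewrite (le_trans h)// ltW.
Qed.

End trig.

(** * Random choices *)

Lemma sum_cond_pow (R : realType) (T : finType) (P : pred T) (t : R) :
  \sum_(x : T) t ^+ P x = #|T|%:R + (t - 1) * #|P|%:R.
Proof.
rewrite (eq_bigr (fun x => 1 + (t - 1) * (P x)%:R)); last first.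
  by move=> x _; case: (P x); rewrite ?expr1 ?expr0 ?mulr1 ?mulr0 ?addr0//; lra.
rewrite big_split/= sumr_const -mulr_sumr; congr (_ + _ * _).
rewrite -natr_sum -sum1_card [in RHS]big_mkcond/=.
by congr (_%:R); apply: eq_bigr => x _; rewrite unfold_in; case: (P x).
Qed.

(* Averaging t ^+ #bad over all choice functions: the average factorises over
   the coordinates. *)
Lemma chernoff_choice (R : realType) (I T W : finType) (B : W -> I -> pred T)
    (t E : R) : (0 < #|T|)%N -> (0 < #|W|)%N -> 1 <= t ->
  (forall w, (\sum_i #|B w i|)%N%:R <= E * #|T|%:R) ->
  exists F : {ffun I -> T}, forall w,
    t ^+ #|[pred i | B w i (F i)]| <= #|W|%:R * expR ((t - 1) * E).
Proof.
move=> T0 W0 t1 BE.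
have t0 : 0 <= t by lra.
apply: contrapT => /forallNP noF.
have TR : 0 < #|T|%:R :> R by rewrite ltr0n.
have total w : \sum_(F : {ffun I -> T}) t ^+ #|[pred i | B w i (F i)]| <=
    #|T|%:R ^+ #|I| * expR ((t - 1) * E).
  have -> : \sum_(F : {ffun I -> T}) t ^+ #|[pred i | B w i (F i)]| =
      \prod_i \sum_(x : T) t ^+ B w i x.
    rewrite bigA_distr_bigA/=; apply: eq_bigr => F _.
    rewrite prodrXr -sum1_card [in LHS]big_mkcond/=; congr (_ ^+ _).
  have -> : #|T|%:R ^+ #|I| * expR ((t - 1) * E) =
      expR ((t - 1) * E) * \prod_(i : I) (#|T|%:R : R).
    by rewrite prodr_const mulrC.
  (* With q the proportion of bad choices at [i], the factor is [#|T|] (1 + (t - 1) q), and 1 + x <=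
     exp x. *)
  apply: (@le_trans _ _ (\prod_i (expR ((t - 1) * (#|B w i|%:R / #|T|%:R)) * #|T|%:R))).
    apply: ler_prod => i _; rewrite sum_cond_pow; apply/andP; split.
      by rewrite addr_ge0// mulr_ge0// subr_ge0.
    rewrite -ler_pdivrMr// mulrDl divff ?gt_eqF// -mulrA.
    exact: expR_ge1Dx.
  rewrite big_split/= ler_wpM2r ?prodr_ge0// -expR_sum ler_expR.
  rewrite -mulr_sumr ler_wpM2l ?subr_ge0// -mulr_suml ler_pdivrMr//.
  by rewrite -natr_sum.
(* If every [F] failed for some [w], the sum over [w] would exceed the bound for every [F]; summed
   over all [F], this contradicts [total]. *)
have : \sum_(F : {ffun I -> T}) (#|W|%:R * expR ((t - 1) * E)) <
    \sum_(F : {ffun I -> T}) \sum_w t ^+ #|[pred i | B w i (F i)]|.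
  have /card_gt0P[x0 _] := T0.
  apply: (ltr_sum (P := xpredT)).
    by apply/hasP; exists [ffun=> x0]; rewrite ?mem_index_enum.
  move=> F _; have /existsNP[w /negP] := noF F; rewrite -ltNge => lt.
  rewrite (lt_le_trans lt)// (bigD1 w)//= lerDl sumr_ge0// => *.
  exact: exprn_ge0.
rewrite exchange_big/= => lt.
have := lt_le_trans lt (ler_sum _ (fun w _ => total w)).
rewrite !sumr_const card_ffun.
rewrite -[X in X < _]mulr_natr -[X in _ < X]mulr_natr natrX; set e := expR _.
by rewrite (_ : _ * e * _ = #|T|%:R ^+ #|I| * e * #|W|%:R) ?ltxx//; ring.
Qed.

(* Two elements with the same label whose ranks are at most b apart are told
   apart by their ranks modulo b + 1. *)
Lemma card_le_label_rank (S : finType) (A : {pred S}) (lab rk : S -> nat) (a b : nat) :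
  (forall x, x \in A -> (lab x < a)%N) ->
  (forall x y, x \in A -> y \in A -> lab x = lab y -> (rk x <= rk y + b)%N) ->
  (forall x y, x \in A -> y \in A -> lab x = lab y -> rk x = rk y -> x = y) ->
  (#|A| <= a * b.+1)%N.
Proof.
move=> laba rkb inj.
case: a laba => [laba|a laba].
  rewrite leqn0; apply/eqP/eq_card0 => x; apply/negP => xA.
  by have := laba _ xA.
pose f x : 'I_a.+1 * 'I_b.+1 := (inord (lab x), inord (rk x %% b.+1)).
have finj : {in A &, injective f}.
  move=> x y xA yA [] /(congr1 val) + /(congr1 val).
  rewrite /= !inordK ?laba ?ltn_pmod// => lxy rxy.
  apply: inj => //.
  have := rkb _ _ xA yA lxy; have := rkb _ _ yA xA (esym lxy).
  have := divn_eq (rk x) b.+1; have := divn_eq (rk y) b.+1; rewrite rxy.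
  have := ltn_pmod (rk y) (ltn0Sn b).
  move: (rk x %/ b.+1)%N (rk y %/ b.+1)%N (rk y %% b.+1)%N => q1 q2 r _ ey ex h1 h2.
  have [lt|lt|eq] := ltngtP q1 q2; last by rewrite ex ey eq.
    have : (q1.+1 * b.+1 <= q2 * b.+1)%N by rewrite leq_mul2r lt orbT.
    by rewrite mulSn; lia.
  have : (q2.+1 * b.+1 <= q1 * b.+1)%N by rewrite leq_mul2r lt orbT.
    by rewrite mulSn; lia.
by rewrite -(card_in_imset finj) (leq_trans (max_card _))// card_prod !card_ord.
Qed.

(** * Thin slabs along meridians and parallels *)

Section windows.
Context {R : realType}.
Implicit Types (w : 'rV[R]_3) (x y : R).

Lemma cos_lipschitz x y : `|cos x - cos y| <= `|x - y|.
Proof.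
have -> : cos x - cos y = - 2 * (sin ((x + y) / 2) * sin ((x - y) / 2)).
  rewrite [X in cos X - _](_ : _ = (x + y) / 2 + (x - y) / 2); last lra.
  rewrite [X in _ - cos X = _](_ : _ = (x + y) / 2 - (x - y) / 2); last lra.
  by rewrite cosD cosB; ring.
rewrite !normrM normrN (ger0_norm (ler0n _ _)).
have := normr_sin_le ((x - y) / 2).
rewrite normrM [`|2^-1|]ger0_norm ?invr_ge0//.
have := sin_max ((x + y) / 2); have := normr_ge0 (sin ((x + y) / 2)).
have := normr_ge0 (sin ((x - y) / 2)).
set a := `|sin _|; set b := `|sin _|; set c := `|x - y|; nra.
Qed.

Lemma sin_lipschitz x y : `|sin x - sin y| <= `|x - y|.
Proof.
rewrite -!cosBpihalf (_ : x - y = (x - pi / 2) - (y - pi / 2)); last ring.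
exact: cos_lipschitz.
Qed.

(* Along a meridian [dot _ w] is a sinusoid, and two of its values determine
   its two coefficients through a determinant equal to the sine of the
   difference of the arguments. *)
Lemma meridian_window w (b a1 a2 d : R) :
  8^-1 <= `|w 0 0 * cos b + w 0 1 * sin b| \/ 8^-1 <= `|w 0 2%:R| ->
  `|dot (spherical (a1, b)) w| <= d -> `|dot (spherical (a2, b)) w| <= d ->
  `|a1 - a2| <= 1 -> `|a1 - a2| <= 32 * d.
Proof.
rewrite !dot_spherical; set u := _ + _; set v := w 0 2%:R => large g1 g2 small.
set y1 := u * sin a1 + _ in g1; set y2 := u * sin a2 + _ in g2.
have comb (x1 x2 : R) : `|x1| <= 1 -> `|x2| <= 1 -> `|y1 * x1 - y2 * x2| <= 2 * d.
  move=> X1 X2; rewrite (le_trans (ler_normB _ _))// !normrM.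
  have := normr_ge0 y1; have := normr_ge0 y2.
  by have := normr_ge0 x1; have := normr_ge0 x2; nra.
have key : `|sin (a1 - a2)| <= 16 * d.
  have s0 := normr_ge0 (sin (a1 - a2)).
  case: large => large.
    have := comb _ _ (cos_max a2) (cos_max a1).
    rewrite (_ : _ - _ = u * sin (a1 - a2)); last by rewrite /y1 /y2 sinB; ring.
    by rewrite normrM; nra.
  have := comb _ _ (sin_max a2) (sin_max a1).
  rewrite (_ : _ - _ = - (v * sin (a1 - a2))); last by rewrite /y1 /y2 sinB; ring.
  by rewrite normrN normrM; nra.
by have := normr_sin_ge _ small; lra.
Qed.

(** The vertical coordinate of [w] cancels in the difference of the two values, and sum-to-product
    formulas turn the rest into 2 sin a sin((b1 - b2)/2) times the slope at the middle longitude.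
    The factor sin a is why the conclusion bounds [s] times the difference of longitudes, comparable
    to an arc length. Constants: s/2 * 2 * 1/4 * 1/4 = s/16, against 2 d. *)
Lemma parallel_window w (s a b1 b2 d : R) : 0 < s -> s / 2 <= sin a ->
  4^-1 <= `|w 0 1 * cos ((b1 + b2) / 2) - w 0 0 * sin ((b1 + b2) / 2)| ->
  `|dot (spherical (a, b1)) w| <= d -> `|dot (spherical (a, b2)) w| <= d ->
  `|b1 - b2| <= 1 -> s * `|b1 - b2| <= 32 * d.
Proof.
move=> s0 sa; set u := _ - _ => large g1 g2 small.
have diff : `|dot (spherical (a, b1)) w - dot (spherical (a, b2)) w| <= 2 * d.
  by rewrite (le_trans (ler_normB _ _))//; lra.
move: diff; rewrite !dot_spherical.
rewrite (_ : _ - _ = sin a * (2 * (sin ((b1 - b2) / 2) * u))); last first.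
  rewrite /u.
  rewrite [in cos b1](_ : b1 = (b1 + b2) / 2 + (b1 - b2) / 2); last lra.
  rewrite [in sin b1](_ : b1 = (b1 + b2) / 2 + (b1 - b2) / 2); last lra.
  rewrite [in cos b2](_ : b2 = (b1 + b2) / 2 - (b1 - b2) / 2); last lra.
  rewrite [in sin b2](_ : b2 = (b1 + b2) / 2 - (b1 - b2) / 2); last lra.
  by rewrite !(cosD, sinD, cosN, sinN); ring.
have h2 : `|(b1 - b2) / 2| = `|b1 - b2| / 2.
  by rewrite normrM [`|2^-1|]ger0_norm ?invr_ge0.
have := normr_sin_ge ((b1 - b2) / 2); rewrite h2.
rewrite !normrM [`|2|]ger0_norm//.
have := normr_ge0 (b1 - b2).
set t := `|b1 - b2| in small *; set S := `|sin ((b1 - b2) / 2)|.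
move=> t0 /(_ ltac:(lra)) S1.
have sa' : s / 2 <= `|sin a| by rewrite (le_trans sa)// ler_norm.
have : (s / 2) * (2 * ((t / 4) * 4^-1)) <= `|sin a| * (2 * (S * `|u|)).
  apply: ler_pM => //; [lra|nra|].
  rewrite ler_pM2l//; apply: ler_pM => //; [lra|lra].
by nra.
Qed.

(** Rotating the horizontal plane by [b0] splits [dot w w] into three squares: the horizontal
    component towards longitude [b0], the one orthogonal to it, and the vertical one. If the first
    is below 1/4 and the last below 1/8, the second exceeds 1/2. Moving the longitude by 1/100
    changes a component by at most 1/25. *)
Lemma direction_dichotomy w (b0 : R) : 2^-1 <= dot w w ->
  `|w 0 0| <= 2 -> `|w 0 1| <= 2 ->
  (forall b, `|b - b0| <= 100^-1 ->
     8^-1 <= `|w 0 0 * cos b + w 0 1 * sin b| \/ 8^-1 <= `|w 0 2%:R|) \/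
  (forall b, `|b - b0| <= 100^-1 ->
     4^-1 <= `|w 0 1 * cos b - w 0 0 * sin b|).
Proof.
move=> ww w0 w1.
have close b (u v : R) : `|u| <= 2 -> `|v| <= 2 -> `|b - b0| <= 100^-1 ->
    `|u * cos b0 + v * sin b0| - 25^-1 <= `|u * cos b + v * sin b|.
  move=> u2 v2 bb; rewrite lerBlDr -lerBlDl.
  rewrite (le_trans (lerB_dist _ _))//.
  rewrite (_ : _ - _ = u * (cos b0 - cos b) + v * (sin b0 - sin b)); last ring.
  rewrite (le_trans (ler_normD _ _))// !normrM.
  have := cos_lipschitz b0 b; have := sin_lipschitz b0 b.
  rewrite distrC (distrC (sin _)) (distrC (cos _)) (distrC b0).
  have := normr_ge0 (cos b - cos b0); have := normr_ge0 (sin b - sin b0).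
  by have := normr_ge0 u; have := normr_ge0 v; nra.
have [l0|l0] := leP 4^-1 `|w 0 0 * cos b0 + w 0 1 * sin b0|.
  by left=> b bb; left; have := close b _ _ w0 w1 bb; lra.
have [l1|l1] := leP 8^-1 `|w 0 2%:R|; first by left=> b _; right.
right=> b bb; have := close b (w 0 1) (- w 0 0) w1; rewrite normrN => /(_ w0 bb).
rewrite !mulNr; apply: le_trans.
suff : 2^-1 <= `|w 0 1 * cos b0 - w 0 0 * sin b0| by lra.
move: l0 l1; set u := _ + _; set v := w 0 2%:R; set z := _ - _ => l0 l1.
have eq : dot w w = `|u| ^+ 2 + `|z| ^+ 2 + `|v| ^+ 2.
  rewrite !real_normK ?num_real// dotE.
  transitivity ((w 0 0 ^+ 2 + w 0 1 ^+ 2) * (cos b0 ^+ 2 + sin b0 ^+ 2) + v ^+ 2).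
    by rewrite cos2Dsin2 /v; ring.
  by rewrite /u /z; ring.
have := normr_ge0 u; have := normr_ge0 v; have := normr_ge0 z; rewrite eq in ww.
by nra.
Qed.

End windows.

(** * The grid *)

(* The index [j] lives in the slot [j %% K ^ 2], that is in one of K bands of
   equal area cut into K sectors. *)
Definition band (K j : nat) : nat := ((j %% K ^ 2) %/ K)%N.
Definition sector (K j : nat) : nat := ((j %% K ^ 2) %% K)%N.

Lemma slot_band_lt K s : (s < K ^ 2)%N -> (band K s < K)%N.
Proof.
move=> sK; have K0 : (0 < K)%N by case: K sK.
by rewrite /band ltn_divLR// mulnn ltn_pmod// expn_gt0 K0.
Qed.

Lemma band_lt K (K0 : (0 < K)%N) j : (band K j < K)%N.
Proof.
rewrite (_ : band K j = band K (j %% K ^ 2)); last by rewrite /band modn_mod.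
by rewrite slot_band_lt// ltn_pmod// expn_gt0 K0.
Qed.

Lemma sector_lt K (K0 : (0 < K)%N) j : (sector K j < K)%N.
Proof. by rewrite ltn_pmod. Qed.

Lemma offset_le (m q e : nat) : (e < m)%N -> (2 * m * q + e <= q.+1 * 2 * m)%N.
Proof.
move=> em; rewrite -(mulnA q.+1) (mulSnr q) (mulnC q) leq_add2l.
by rewrite (leq_trans (ltnW em))// leq_pmull.
Qed.

Section grid.
Context {R : realType}.
Variables m K : nat.

(* A point of the band [i] has its colatitude slightly larger than the middle
   one, [band_angle i], so that its sine is at least [sin (band_angle i) / 2]
   even next to the poles.  In each slot the points sit on a rectangular grid of
   geodesic mesh [mesh], with [ncols i] columns; each point is moved by [e] and
   [g] steps of size [mesh / (2 m)], [e, g < m] being the random choice. *)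
Definition band_angle (i : nat) : R := acos (1 - i.*2.+1%:R / K%:R).
Definition mesh : R := (4 * Num.sqrt m%:R)^-1.
Definition ncols (i : nat) : nat :=
  Num.truncn (sin (band_angle i) / (K%:R * mesh)).
Definition grid_row (j : nat) : nat := ((j %/ K ^ 2) %/ ncols (band K j))%N.
Definition grid_col (j : nat) : nat := ((j %/ K ^ 2) %% ncols (band K j))%N.
Definition colat (j e : nat) : R :=
  band_angle (band K j) + mesh / (2 * m%:R) * (2 * m * grid_row j + e)%:R.
Definition longi (j g : nat) : R :=
  pi *+ 2 * (sector K j)%:R / K%:R +
  mesh / (2 * m%:R) / sin (band_angle (band K j)) * (2 * m * grid_col j + g)%:R.

Lemma mesh_sqrt : 0 < m%:R :> R -> mesh * Num.sqrt m%:R = 4^-1.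
Proof.
move=> m0; rewrite /mesh invfM -mulrA mulVf ?mulr1// gt_eqF//.
by rewrite sqrtr_gt0.
Qed.

Hypothesis K_ge : (100 <= K)%N.
Hypothesis sqrtm_ge : K%:R ^+ 2 <= Num.sqrt m%:R :> R.

Let K_gt0 : (0 < K)%N. Proof. exact: leq_trans K_ge. Qed.

Let KR_ge : 100 <= K%:R :> R. Proof. by rewrite (ler_nat _ 100). Qed.

Let sqrtm_gt0 : 0 < Num.sqrt m%:R :> R.
Proof. by apply: lt_le_trans sqrtm_ge; have := KR_ge; nra. Qed.

Let m_gt0 : 0 < m%:R :> R. Proof. by rewrite -sqrtr_gt0. Qed.

Let sqrtmE : Num.sqrt m%:R ^+ 2 = m%:R :> R.
Proof. by rewrite sqr_sqrtr. Qed.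

Let meshE := mesh_sqrt m_gt0.

Let mesh_gt0 : 0 < mesh.
Proof. by rewrite /mesh invr_gt0 mulr_gt0. Qed.

(** With u = (2i + 1)/K the squared sine is u (2 - u): both factors are at least 1/K and one of them
    is at least 1. Taking the middle of the band is what gives this bound in the polar bands too. *)
Lemma band_angle_bounds i : (i < K)%N ->
  [/\ cos (band_angle i) = 1 - i.*2.+1%:R / K%:R,
      0 <= band_angle i <= pi,
      K%:R^-1 <= sin (band_angle i) ^+ 2,
      K%:R^-1 <= sin (band_angle i) &
      sin (band_angle i) <= 1].
Proof.
move=> iK.
have K0 : 0 < K%:R :> R by have := KR_ge; lra.
set u : R := i.*2.+1%:R / K%:R.
have Kv : K%:R * K%:R^-1 = 1 :> R by rewrite divff// gt_eqF.
have uK : u * K%:R = i.*2.+1%:R by rewrite /u divfK// gt_eqF.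
have u1 : K%:R^-1 <= u by rewrite /u ler_pdivlMr// mulVf ?gt_eqF// (ler_nat _ 1).
have u2 : K%:R^-1 <= 2 - u.
  rewrite -(ler_pM2r K0) mulrBl uK mulVf ?gt_eqF//.
  by rewrite lerBrDr -natrM -(natrD _ 1) ler_nat; lia.
have v0 : 0 < K%:R^-1 :> R by rewrite invr_gt0.
have bnd : -1 <= 1 - u <= 1 by apply/andP; split; lra.
have ce : cos (band_angle i) = 1 - u by rewrite acosK ?in_itv/=.
have ge0 : 0 <= band_angle i by exact: acos_ge0.
have lepi : band_angle i <= pi by exact: acos_lepi.
have s0 : 0 <= sin (band_angle i) by rewrite sin_ge0_pi// ge0.
have sq : K%:R^-1 <= sin (band_angle i) ^+ 2.
  rewrite sin2cos2 ce; have [|] := leP u 1; nra.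
have s1 := sin_le1 (band_angle i).
split => //; first by rewrite ge0.
by apply: le_trans sq _; nra.
Qed.

(** Since the squared sine s^2 is at least 1/K, the range of x gives x <= s/2, which keeps the sine
    above s/2. The cosine drops by at most x s + x^2/2 <= 1/(2K) + 1/(8K), less than the 1/K that
    separates the middle of the band from its end. *)
Lemma band_range i (x : R) : (i < K)%N ->
  0 <= x <= (2 * K%:R * sin (band_angle i))^-1 ->
  [/\ 0 <= band_angle i + x <= pi,
      sin (band_angle i) / 2 <= sin (band_angle i + x) &
      1 - i.+1.*2%:R / K%:R <= cos (band_angle i + x) <= 1 - i.*2.+1%:R / K%:R].
Proof.
move=> iK /andP[x0].
have [ce /andP[t0 tpi] sq s0 s1] := band_angle_bounds _ iK.
have K0 : 0 < K%:R :> R by have := KR_ge; lra.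
have v0 : 0 < K%:R^-1 :> R by rewrite invr_gt0.
set s := sin (band_angle i) in sq s0 s1 *; set t := band_angle i in ce t0 tpi *.
rewrite invfM invfM => xr.
have sv : s * s^-1 = 1 by rewrite divff// gt_eqF//; lra.
have sv0 : 0 < s^-1 by rewrite invr_gt0; lra.
have xs : x * s <= K%:R^-1 / 2.
  by have : x * s <= 2^-1 * K%:R^-1 * s^-1 * s; [nra | rewrite -mulrA (mulrC s^-1) sv; lra].
have xs2 : x <= s / 2.
  by rewrite -(ler_pM2r (_ : 0 < s)) ?(lt_le_trans v0)//; nra.
have tx : x <= pi - t.
  have : s <= pi - t.
    rewrite /s -[sin _]opprK -sinN -[leLHS]opprK.
    have -> : - sin (- t) = sin (pi - t) by rewrite sinB sinpi cospi sinN; lra.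
    by rewrite opprK sin_le//; lra.
  by lra.
have c1 := cos_ge x; have c2 := cos_le1 x.
split.
- by apply/andP; split; lra.
- have := sin_lipschitz t (t + x); rewrite opprD addNKr normrN (ger0_norm x0).
  by rewrite -/s ler_norml => /andP[]; lra.
- apply/andP; split; last first.
    apply: (@le_trans _ _ (cos t)); last by rewrite ce.
    rewrite leNgt; apply/negP; rewrite ltr_cos ?in_itv/=; lra.
  have s2 := sin_le _ x0.
  have sx0 : 0 <= sin x by apply: sin_ge0_pi; lra.
  rewrite cosD -/s; change (cos (band_angle i)) with (cos t); rewrite ce.
  have -> : i.+1.*2%:R / K%:R = i.*2.+1%:R / K%:R + K%:R^-1 :> R.
    by rewrite doubleS -[(_.+2)%N]addn1 natrD mulrDl mul1r.
  rewrite opprD addrA; set C := 1 - i.*2.+1%:R / K%:R in ce *.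
  have C1 : -1 <= C <= 1 by move: ce => <-; rewrite cos_geN1 cos_le1.
  have xx : x ^+ 2 <= K%:R^-1 / 4 by nra.
  have : C * cos x >= C - x ^+ 2 / 2 by nra.
  by nra.
Qed.

(** The truncated quotient is at least 1, because the sine is at least 1/K and sqrt m >= K^2; hence
    truncation at most halves it. *)
Lemma ncols_bounds i : (i < K)%N -> [/\ (0 < ncols i)%N,
  (ncols i)%:R * (K%:R * mesh) <= sin (band_angle i) &
  sin (band_angle i) / 2 <= (ncols i)%:R * (K%:R * mesh)].
Proof.
move=> iK; have [_ _ _ s0 s1] := band_angle_bounds _ iK.
have K0 : 0 < K%:R :> R by have := KR_ge; lra.
have Kh : 0 < K%:R * mesh by rewrite mulr_gt0.
set s := sin _ in s0 s1 *.
have ge1 : 1 <= s / (K%:R * mesh).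
  rewrite ler_pdivlMr// mul1r (le_trans _ s0)// -(ler_pM2l K0) mulfV ?gt_eqF//.
  rewrite -(ler_pM2r sqrtm_gt0) -!mulrA meshE mul1r.
  by have := sqrtm_ge; have := KR_ge; rewrite expr2; nra.
have gt0 : (0 < ncols i)%N by rewrite truncn_gt0.
have ncols1 : 1 <= (ncols i)%:R :> R by rewrite (ler_nat _ 1).
have /andP[] := truncn_itv (le_trans ler01 ge1).
rewrite -/(ncols i) ler_pdivlMr// => h1.
rewrite ltr_pdivrMr// -[_.+1]addn1 natrD => h2.
by split => //; nra.
Qed.

Lemma grid_row_col j : (j %/ K ^ 2 = grid_row j * ncols (band K j) + grid_col j)%N.
Proof. exact: divn_eq. Qed.

Lemma col_lt j : (grid_col j < ncols (band K j))%N.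
Proof. by rewrite ltn_pmod//; have [] := ncols_bounds _ (band_lt _ K_gt0 j). Qed.

(** The r complete rows before [j] hold r n points of a slot, so r n K^2 <= m; with n >= s/(2 K h)
    this gives r h <= 1/(8 K s). The one additional row fits because h <= 1/(400 K). *)
Lemma row_bound j : (j < m)%N ->
  (grid_row j).+1%:R * mesh <= (2 * K%:R * sin (band_angle (band K j)))^-1.
Proof.
move=> jm; have [n0 _] := ncols_bounds _ (band_lt _ K_gt0 j).
have [_ _ _ s0 s1] := band_angle_bounds _ (band_lt _ K_gt0 j).
set n := ncols _ in n0 *; set s := sin _ in s0 s1 * => ns.
have K0 : 0 < K%:R :> R by have := KR_ge; lra.
have v0 : 0 < K%:R^-1 :> R by rewrite invr_gt0.
have : (grid_row j * n * K ^ 2 <= m)%N.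
  rewrite (leq_trans _ (ltnW jm))// (leq_trans _ (leq_trunc_div j (K ^ 2)))//.
  by rewrite leq_mul2r grid_row_col leq_addr orbT.
rewrite -(ler_nat R) natrM natrX natrM -sqrtmE => le.
rewrite -[leRHS]mul1r ler_pdivlMr; last by rewrite !mulr_gt0//; lra.
have e : 4 * mesh * Num.sqrt m%:R = 1 by have := meshE; lra.
have h0 := mesh_gt0; have Sge := sqrtm_ge; have S0 := sqrtm_gt0.
have hS := meshE; have k100 := KR_ge.
set r := (grid_row j)%:R in le *; set h := mesh in ns e h0 hS *.
set S := Num.sqrt _ in le e Sge S0 hS; set k := K%:R in ns le K0 v0 s0 Sge k100 *.
rewrite -[(grid_row j).+1]addn1 natrD -/r.
have r0 : 0 <= r by rewrite ler0n.
have n1 : 0 <= n%:R :> R by rewrite ler0n.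
(* r n k^2 <= S^2 = 1/(16 h^2) and s <= 2 n k h *)
have h1 : r * (n%:R * k * h) * (k * (16 * h)) <= 1.
  have -> : r * (n%:R * k * h) * (k * (16 * h)) = (r * n%:R * k ^+ 2) * (16 * h ^+ 2) by ring.
  apply: (@le_trans _ _ (S ^+ 2 * (16 * h ^+ 2))).
    by rewrite ler_wpM2r// mulr_ge0// sqr_ge0.
  have -> : S ^+ 2 * (16 * h ^+ 2) = (4 * h * S) ^+ 2 by ring.
  by rewrite e expr1n.
have h2 : r * (s / 2) * (k * (16 * h)) <= 1.
  apply: le_trans h1; rewrite ler_wpM2r; [by []|by rewrite mulr_ge0//; lra|].
  by rewrite ler_wpM2l//; rewrite mulrA in ns.
have h3 : h * k * 400 <= 1.
  have : k * 100 <= S by apply: le_trans Sge; rewrite expr2; nra.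
  by rewrite -(ler_pM2l h0) hS; lra.
have : h * k * s <= 400^-1 by nra.
by nra.
Qed.

Lemma row_mesh j e : (j < m)%N -> (e < m)%N ->
  0 <= mesh / (2 * m%:R) * (2 * m * grid_row j + e)%:R <=
    (2 * K%:R * sin (band_angle (band K j)))^-1.
Proof.
have h0 := mesh_gt0; have m0 := m_gt0.
move=> jm em; apply/andP; split; first by rewrite mulr_ge0// divr_ge0//; lra.
apply: le_trans (row_bound _ jm).
rewrite mulrAC ler_pdivrMr; last by lra.
have : (2 * m * grid_row j + e)%:R <= (grid_row j).+1%:R * (2 * m%:R) :> R.
  by rewrite mulrA -!natrM ler_nat offset_le.
by rewrite mulrAC (mulrC _ mesh) ler_pM2l.
Qed.

Lemma col_mesh j g : (g < m)%N ->
  0 <= mesh / (2 * m%:R) / sin (band_angle (band K j)) * (2 * m * grid_col j + g)%:R <=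
    K%:R^-1.
Proof.
have h0 := mesh_gt0; have m0 := m_gt0.
move=> gm; have [_ _ _ s0 s1] := band_angle_bounds _ (band_lt _ K_gt0 j).
have [_ ns _] := ncols_bounds _ (band_lt _ K_gt0 j).
have K0 : 0 < K%:R :> R by have := KR_ge; lra.
have v0 : 0 < K%:R^-1 :> R by rewrite invr_gt0.
have c : (grid_col j).+1%:R <= (ncols (band K j))%:R :> R by rewrite ler_nat col_lt.
set s := sin _ in s0 s1 ns *.
have s_gt0 : 0 < s by lra.
apply/andP; split; first by rewrite mulr_ge0// !divr_ge0//; lra.
rewrite mulrAC ler_pdivrMr// mulrAC ler_pdivrMr; last by lra.
have : (2 * m * grid_col j + g)%:R <= (grid_col j).+1%:R * (2 * m%:R) :> R.
  by rewrite mulrA -!natrM ler_nat offset_le.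
move=> le; apply: (@le_trans _ _ (mesh * ((grid_col j).+1%:R * (2 * m%:R)))).
  by rewrite ler_wpM2l// ltW.
rewrite mulrA ler_wpM2r//.
rewrite ler_pdivlMl//; apply: le_trans ns.
have -> : K%:R * (mesh * (grid_col j).+1%:R) = (grid_col j).+1%:R * (K%:R * mesh) by ring.
by rewrite ler_wpM2r// mulr_ge0// ltW.
Qed.

End grid.

(** * Separation of the displaced grid points *)

Section sep.
Context {R : realType}.

Lemma one_sub_cos_ge (e x : R) : 0 <= e <= 1 -> 2 * e <= `|x| <= 2 * pi - 2 * e ->
  e ^+ 2 / 2 <= 1 - cos x.
Proof.
move=> e01 /andP[x1 x2]; rewrite -cos_norm one_sub_cos.
have : e / 2 <= sin (`|x| / 2) by apply: sin_ge_margin => //; apply/andP; split; lra.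
by case/andP: e01 => e0 _; nra.
Qed.

Lemma natr_dist_ge (a b n : nat) : (a + n <= b)%N || (b + n <= a)%N ->
  n%:R <= `|a%:R - b%:R| :> R.
Proof.
move=> /orP[] le; [rewrite distrC|]; rewrite (le_trans _ (ler_norm _))//;
by rewrite lerBrDr -natrD ler_nat addnC.
Qed.

(** Neighbouring grid lines are 2m steps apart and a displacement uses fewer than m steps, so at
    least m steps, half a mesh, remain. *)
Lemma spread_label (m q q' e e' : nat) : (e < m)%N -> (e' < m)%N -> q != q' ->
  m%:R <= `|(2 * m * q + e)%:R - (2 * m * q' + e')%:R| :> R.
Proof.
move=> em em' qq; apply: natr_dist_ge.
move: qq; rewrite neq_ltn => /orP[] lt; apply/orP; [left|right].
  have : (2 * m * q.+1 <= 2 * m * q')%N by rewrite leq_mul2l lt orbT.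
  by rewrite mulnS; lia.
have : (2 * m * q'.+1 <= 2 * m * q)%N by rewrite leq_mul2l lt orbT.
by rewrite mulnS; lia.
Qed.

Lemma dot_far_colat (d t t' p p' : R) :
  0 <= d <= 1 -> 0 <= t <= pi -> 0 <= t' <= pi -> 4 * d <= `|t - t'| ->
  dot (spherical (t, p)) (spherical (t', p')) <= 1 - d ^+ 2 / 2.
Proof.
move=> /andP[d0 d1] /andP[t0 tpi] /andP[t0' tpi'] tt; rewrite dot_spherical2.
have pi2 := pi_ge2 R.
have ttpi : `|t - t'| <= pi by rewrite ler_norml; apply/andP; split; lra.
have : (d / 2) ^+ 2 * 2 <= 1 - cos (t - t').
  rewrite (_ : _ * 2 = d ^+ 2 / 2); last by field.
  by apply: one_sub_cos_ge; apply/andP; split; lra.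
have : 0 <= sin t * sin t' * (1 - cos (p - p')).
  rewrite !mulr_ge0 ?subr_ge0 ?cos_le1//; apply: sin_ge0_pi.
    by rewrite t0.
  by rewrite t0'.
lra.
Qed.

(** The longitude term of the haversine formula is at least (s/2)^2 c^2/2, which is at least d^2/2
    since s c >= 2 d. *)
Lemma dot_far_longi (d c s t t' p p' : R) :
  0 <= d -> 0 <= s -> s / 2 <= sin t -> s / 2 <= sin t' ->
  0 <= c <= 1 -> 2 * d <= s * c -> 2 * c <= `|p - p'| <= 2 * pi - 2 * c ->
  dot (spherical (t, p)) (spherical (t', p')) <= 1 - d ^+ 2 / 2.
Proof.
move=> d0 s0 st st' c01 sc pp; rewrite dot_spherical2.
have C := one_sub_cos_ge _ _ c01 pp; have c1 := cos_le1 (t - t').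
have : s / 2 * (s / 2) * (c ^+ 2 / 2) <= sin t * sin t' * (1 - cos (p - p')).
  have s2 : 0 <= s / 2 by lra.
  apply: ler_pM => //; first by rewrite mulr_ge0.
    by rewrite divr_ge0// sqr_ge0.
  exact: ler_pM.
have : (2 * d) ^+ 2 <= (s * c) ^+ 2.
  by rewrite lerXn2r ?nnegrE//; case/andP: c01 => c0 _; [rewrite mulr_ge0|rewrite mulr_ge0].
by rewrite !exprMn; lra.
Qed.

(** Only the first 1/k of each sector of width 2 pi/k is occupied, and 2 pi - 1 >= 1. The upper
    bound handles the last and the first sector, which are neighbours across longitude 0. *)
Lemma sectors_apart (k a b : nat) (x y : R) : (a < b)%N -> (b < k)%N ->
  pi *+ 2 * a%:R / k%:R <= x <= pi *+ 2 * a%:R / k%:R + k%:R^-1 ->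
  pi *+ 2 * b%:R / k%:R <= y <= pi *+ 2 * b%:R / k%:R + k%:R^-1 ->
  k%:R^-1 <= y - x <= 2 * pi - k%:R^-1.
Proof.
move=> ab bk; have pi2 := pi_ge2 R.
have k0 : 0 < k%:R :> R by rewrite ltr0n (leq_trans _ bk).
have v0 : 0 < k%:R^-1 :> R by rewrite invr_gt0.
have kv : k%:R * k%:R^-1 = 1 :> R by rewrite divff// gt_eqF.
have A : a%:R * k%:R^-1 + k%:R^-1 <= b%:R * k%:R^-1 :> R.
  by rewrite -[X in _ + X <= _]mul1r -mulrDl ler_pM2r// natr1 ler_nat.
have B : b%:R * k%:R^-1 + k%:R^-1 <= 1 :> R.
  by rewrite -[X in _ + X <= _]mul1r -mulrDl -[leRHS]kv ler_pM2r// natr1 ler_nat.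
have a0 : 0 <= a%:R * k%:R^-1 :> R by rewrite mulr_ge0// ltW.
rewrite -!mulrA -!(mulr_natl pi 2).
move: (k%:R^-1) (a%:R / k%:R) (b%:R / k%:R) A B a0 v0 => v u w A B a0 v0.
by move=> /andP[x1 x2] /andP[y1 y2]; apply/andP; split; nra.
Qed.

Variables m K : nat.
Hypothesis K_ge : (100 <= K)%N.
Let K_gt0 : (0 < K)%N. Proof. exact: leq_trans K_ge. Qed.
Hypothesis sqrtm_ge : K%:R ^+ 2 <= Num.sqrt m%:R :> R.

Local Notation h := (@mesh R m).
Local Notation s j := (sin (@band_angle R K (band K j))).
Definition gridpt (j e g : nat) : 'rV[R]_3 :=
  spherical (colat m K j e, longi m K j g).

Lemma mesh_bounds : [/\ 100 <= K%:R :> R, 0 < m%:R :> R, 0 < h,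
  16 * h ^+ 2 * m%:R = 1 & 4 * h * K%:R ^+ 2 <= 1].
Proof.
have KR : 100 <= K%:R :> R by rewrite (ler_nat _ 100).
have S0 : 0 < Num.sqrt m%:R :> R by apply: lt_le_trans sqrtm_ge; nra.
have m0 : 0 < m%:R :> R by rewrite -sqrtr_gt0.
have e : 4 * h * Num.sqrt m%:R = 1.
  by rewrite /mesh invfM mulrA divff// mul1r mulVf// gt_eqF.
have h0 : 0 < h by rewrite /mesh invr_gt0 mulr_gt0.
split=> //.
  have <- : Num.sqrt m%:R ^+ 2 = m%:R :> R by rewrite sqr_sqrtr.
  have -> : 16 * h ^+ 2 * Num.sqrt m%:R ^+ 2 = (4 * h * Num.sqrt m%:R) ^+ 2 by ring.
  by rewrite e expr1n.
by rewrite -[leRHS]e ler_wpM2l// mulr_ge0// ltW.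
Qed.

Lemma slot_index_inj j k : band K j = band K k -> sector K j = sector K k ->
  (j %/ K ^ 2)%N = (k %/ K ^ 2)%N -> j = k.
Proof.
rewrite /band /sector => eb es eq.
rewrite (divn_eq j (K ^ 2)) (divn_eq k (K ^ 2)) eq; congr (_ + _)%N.
by rewrite (divn_eq (j %% K ^ 2) K) (divn_eq (k %% K ^ 2) K) eb es.
Qed.

Lemma gridpt_cell j e g : (j < m)%N -> (e < m)%N -> (g < m)%N ->
  [/\ 0 <= @colat R m K j e <= pi,
      s j / 2 <= sin (colat m K j e),
      1 - (band K j).+1.*2%:R / K%:R <= cos (@colat R m K j e) <=
        1 - (band K j).*2.+1%:R / K%:R &
      pi *+ 2 * (sector K j)%:R / K%:R <= @longi R m K j g <=
        pi *+ 2 * (sector K j)%:R / K%:R + K%:R^-1].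
Proof.
move=> jm em gm.
have /(band_range _ _ K_ge sqrtm_ge _ _ (band_lt _ K_gt0 j)) [t1 t2 t3] :=
  row_mesh _ _ K_ge sqrtm_ge _ _ jm em.
have /andP[p1 p2] := col_mesh _ _ K_ge sqrtm_ge j _ gm.
by split => //; rewrite /longi lerDl p1 lerD2l.
Qed.

End sep.

Local Notation sin_band R K j := (sin (@band_angle R K (band K j))).

Lemma gridpt_sep (R : realType) (m K : nat) (K_ge : (100 <= K)%N)
    (sqrtm_ge : K%:R ^+ 2 <= Num.sqrt m%:R :> R) j k e g e' g' :
  (j < m)%N -> (k < m)%N -> j <> k -> (e < m)%N -> (g < m)%N -> (e' < m)%N -> (g' < m)%N ->
  @mesh R m / 8 <= gdist (gridpt m K j e g) (@gridpt R m K k e' g').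
Proof.
set h := mesh m; have K_gt0 : (0 < K)%N by exact: leq_trans K_ge.
move=> jm km jk em gm em' gm'.
apply: gdist_ge; [exact: spherical_sphere|exact: spherical_sphere|].
have [KR m0 h0 _ hK] := mesh_bounds _ _ K_ge sqrtm_ge; rewrite -/h in h0 hK.
have h2m : 0 <= h / (2 * m%:R) by rewrite divr_ge0 ?mulr_ge0 ?(ltW h0) ?(ltW m0).
have pi4 := @pi_le4 R; have pi2 := pi_ge2 R.
have [/andP[t0 tpi] ts tc tp] := gridpt_cell _ _ K_ge sqrtm_ge _ _ _ jm em gm.
have [/andP[t0' tpi'] ts' tc' tp'] := gridpt_cell _ _ K_ge sqrtm_ge _ _ _ km em' gm'.
have [_ _ s2 s0 s1] := band_angle_bounds _ _ K_ge sqrtm_ge _ (band_lt _ K_gt0 j).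
have K0 : 0 < K%:R :> R by by rewrite ltr0n.
have v0 : 0 < K%:R^-1 :> R by rewrite invr_gt0.
have Kv : K%:R * K%:R^-1 = 1 :> R by rewrite divff// gt_eqF.
(* The margins between slots are of order 1/K in the cosine or in the longitude; this makes them
   larger than the mesh, even after multiplication by a sine that may be as small as 1/K. *)
have hv : 4 * h <= K%:R^-1 ^+ 2.
  have : 0 < K%:R ^+ 2 :> R by rewrite exprn_gt0.
  by move=> K20; rewrite -(ler_pM2r K20) -exprMn (mulrC _^-1) Kv expr1n.
have v1 : K%:R^-1 <= 100^-1 :> R by rewrite lef_pV2// posrE.
set t := colat m K j e in t0 tpi ts tc *; set t' := colat m K k e' in t0' tpi' ts' tc' *.
set p := longi m K j g in tp *; set p' := longi m K k g' in tp' *.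
have sj0 : 0 < (sin_band R K j) by exact: lt_le_trans v0 s0.
have hK2 : h <= K%:R^-1 by clear -h0 hv v0 v1; nra.
have by_theta : h / 2 <= `|t - t'| ->
    dot (gridpt m K j e g) (gridpt m K k e' g') <= 1 - (h / 8) ^+ 2 / 2.
  move=> tt; apply: dot_far_colat; rewrite ?t0 ?t0' //; last by clear -tt; lra.
  by clear -h0 hK2 v1; apply/andP; split; lra.
(* Each band is occupied only in its half of smaller cosine, so the cosines of points in different
   bands differ by at least 1/K. *)
have [bb|bb] := eqVneq (band K j) (band K k); last first.
  apply: by_theta; apply: le_trans (cos_lipschitz t t').
  apply: (@le_trans _ _ K%:R^-1); first by clear -h0 hK2; lra.
  move: tc tc'; move: bb; rewrite neq_ltn => /orP[] lt /andP[a1 a2] /andP[b1 b2].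
    rewrite (le_trans _ (ler_norm _))//.
    have : ((band K j).+1.*2.+1%:R : R) <= (band K k).*2.+1%:R by rewrite ler_nat ltnS leq_double.
    rewrite -(ler_pM2r v0) -[in X in X <= _]addn1 natrD mulrDl mul1r.
  by clear -a1 a2 b1 b2; lra.
  rewrite distrC (le_trans _ (ler_norm _))//.
  have : ((band K k).+1.*2.+1%:R : R) <= (band K j).*2.+1%:R by rewrite ler_nat ltnS leq_double.
  rewrite -(ler_pM2r v0) -[in X in X <= _]addn1 natrD mulrDl mul1r.
  by clear -a1 a2 b1 b2; lra.
rewrite -bb in ts'.
have [ss|ss] := eqVneq (sector K j) (sector K k); last first.
  have pp : K%:R^-1 <= `|p - p'| <= 2 * pi - K%:R^-1.
    move: ss; rewrite neq_ltn => /orP[] lt.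
      have /andP[q1 q2] := sectors_apart _ _ _ _ _ lt (sector_lt _ K_gt0 k) tp tp'.
      by rewrite distrC ger0_norm ?q1//; clear -q1 q2 v0; lra.
    have /andP[q1 q2] := sectors_apart _ _ _ _ _ lt (sector_lt _ K_gt0 j) tp' tp.
    by rewrite ger0_norm ?q1//; clear -q1 q2 v0; lra.
  apply: (dot_far_longi _ (K%:R^-1 / 2) (sin_band R K j)) => //; [by rewrite divr_ge0 ?(ltW h0)|exact: (ltW sj0)| | |].
  - by clear -v0 v1; apply/andP; split; lra.
  - by clear -v0 s0 hv h0 s2 s1; nra.
  - by clear -pp; case/andP: pp => *; apply/andP; split; lra.
have qq : (j %/ K ^ 2 != k %/ K ^ 2)%N.
  by apply/eqP => qq; apply: jk; exact: (@slot_index_inj K).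
have [rr|rr] := eqVneq (@grid_row R m K j) (@grid_row R m K k); last first.
  apply: by_theta; rewrite /t /t' /colat -bb opprD addrACA subrr add0r -mulrBr normrM.
  rewrite (ger0_norm h2m).
  have -> : h / 2 = h / (2 * m%:R) * m%:R.
    by rewrite invfM mulrA mulfVK// gt_eqF.
  rewrite ler_wpM2l//.
  exact: spread_label.
(* Same slot and same row: only the column can distinguish the indices. The colatitudes may still
   differ through [e] and [e'], which only lowers the inner product. *)
have cc : @grid_col R m K j != @grid_col R m K k.
  apply: contra_neq qq => cc.
  by rewrite (@grid_row_col R m K j) (@grid_row_col R m K k) rr cc bb.
have h2ms : 0 <= h / (2 * m%:R) / (sin_band R K j) by rewrite divr_ge0// ltW.
have pp : h / (2 * (sin_band R K j)) <= `|p - p'|.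
  rewrite /p /p' /longi -bb -ss opprD addrACA subrr add0r -mulrBr normrM.
  rewrite (ger0_norm h2ms).
  have -> : h / (2 * (sin_band R K j)) = h / (2 * m%:R) / (sin_band R K j) * m%:R.
    by rewrite !invfM; field; rewrite !gt_eqF.
  rewrite ler_wpM2l//.
  exact: spread_label.
have pp' : `|p - p'| <= 1.
  rewrite -ss in tp'; case/andP: tp => a1 a2; case/andP: tp' => b1 b2.
  by clear -a1 a2 b1 b2 v0 v1; rewrite ler_norml; apply/andP; split; lra.
have sc : (sin_band R K j) * (h / (4 * (sin_band R K j))) = h / 4 by field; rewrite gt_eqF.
have c1 : 2 * (h / (4 * (sin_band R K j))) = h / (2 * (sin_band R K j)) by field; rewrite gt_eqF.
have c0 : 0 <= h / (4 * (sin_band R K j)) by rewrite divr_ge0 ?mulr_ge0 ?(ltW h0) ?(ltW sj0).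
apply: (dot_far_longi _ (h / (4 * (sin_band R K j))) (sin_band R K j)) => //; [by rewrite divr_ge0 ?(ltW h0)|exact: (ltW sj0)| | |].
- by rewrite c0/=; clear -pp pp' c1; lra.
- by rewrite sc; clear -h0; lra.
- by rewrite c1 pp/=; clear -pp pp' c1 pi2; lra.
Qed.

(** * Expected number of points in a slab *)

Lemma muln_add_inj (n q q' r r' : nat) : (r < n)%N -> (r' < n)%N ->
  (q * n + r = q' * n + r')%N -> q = q' /\ r = r'.
Proof.
move=> rn rn' e; have n0 : (0 < n)%N by exact: leq_ltn_trans rn.
have := congr1 (modn^~ n) e; have := congr1 (divn^~ n) e => /=.
by rewrite !divnMDl// !modnMDl !divn_small// !modn_small// !addn0.
Qed.

Section count.
Context {R : realType}.
Variables m K : nat.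
Hypothesis K_ge : (100 <= K)%N.
Let K_gt0 : (0 < K)%N. Proof. exact: leq_trans K_ge. Qed.
Hypothesis sqrtm_ge : K%:R ^+ 2 <= Num.sqrt m%:R :> R.
Variable Q : nat.
Hypothesis Q_ge : Num.sqrt m%:R <= Q%:R :> R.

Local Notation h := (@mesh R m).
Local Notation s i := (sin (@band_angle R K i)).

(** Here 160 = 32 * 5 is the window constant times the half-width 5/m of the slab. In steps of
    h/(2m) the window has length 320/h = 1280 sqrt m. *)
Let meshQ (x : R) : h / (2 * m%:R) * x <= 160 / m%:R -> x <= (1280 * Q)%:R.
Proof.
have [KR m0 h0 hm hK] := @mesh_bounds R m K K_ge sqrtm_ge.
have e : h * Num.sqrt m%:R = 4^-1 := mesh_sqrt _ m0.
rewrite mulrAC ler_pdivrMr; last by lra.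
rewrite (_ : 160 / _ * _ = 320); last by field; rewrite gt_eqF.
have q := Q_ge; rewrite natrM => le; rewrite -(ler_pM2l h0) (le_trans le)//.
by nra.
Qed.

Lemma grid_row_lt j : (j < m)%N -> (@grid_row R m K j < 2 * Q)%N.
Proof.
move=> jm; rewrite -(ler_nat R).
have [KR m0 h0 hm hK] := @mesh_bounds R m K K_ge sqrtm_ge.
have e : h * Num.sqrt m%:R = 4^-1 := mesh_sqrt _ m0.
have [_ _ _ s0 s1] := band_angle_bounds _ _ K_ge sqrtm_ge _ (band_lt _ K_gt0 j).
have rb := row_bound _ _ K_ge sqrtm_ge _ jm.
have K0 : 0 < K%:R :> R by lra.
have Ks : 1 <= K%:R * s (band K j).
  by rewrite -[leLHS](@divff _ (K%:R : R)) ?gt_eqF// ler_pM2l.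
have rb2 : (@grid_row R m K j).+1%:R * h <= 2^-1.
  by apply: le_trans rb _; rewrite lef_pV2 ?posrE; lra.
have q := Q_ge; rewrite natrM -(ler_pM2r h0); nra.
Qed.

Lemma grid_col_lt j : (j < m)%N -> (@grid_col R m K j < 2 * Q)%N.
Proof.
move=> jm; have := @col_lt R m K K_ge sqrtm_ge j; rewrite -2!(ler_nat R) => le.
have [KR m0 h0 hm hK] := @mesh_bounds R m K K_ge sqrtm_ge.
have e : h * Num.sqrt m%:R = 4^-1 := mesh_sqrt _ m0.
have [_ _ _ s0 s1] := band_angle_bounds _ _ K_ge sqrtm_ge _ (band_lt _ K_gt0 j).
have [_ n1 _] := ncols_bounds _ _ K_ge sqrtm_ge _ (band_lt _ K_gt0 j).
have q := Q_ge; rewrite natrM; apply: le_trans le _.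
have c0 : 0 <= (@ncols R m K (band K j))%:R * h by rewrite mulr_ge0// ltW.
have : (@ncols R m K (band K j))%:R * h <= 4^-1 by nra.
by rewrite -(ler_pM2r h0); nra.
Qed.

Definition in_slab (w : 'rV[R]_3) (j : nat) (x : 'I_m * 'I_m) : bool :=
  `|dot (gridpt m K j x.1 x.2) w| <= 5 / m%:R.

(** There are at most 2 Q m grid lines with their displacements, and the slab meets each in a window
    of at most 1280 Q steps. The bound is O(m^2) for a whole slot, as many as the displacements of a
    single index up to a constant. *)
Lemma slot_count (w : 'rV[R]_3) (c : nat) : 2^-1 <= dot w w ->
  `|w 0 0| <= 2 -> `|w 0 1| <= 2 ->
  (#|[pred x : 'I_m * ('I_m * 'I_m) | (x.1 %% K ^ 2 == c)%N &&
      in_slab w x.1 x.2]|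
    <= 2 * Q * m * (1280 * Q).+1)%N.
Proof.
move=> ww w0 w1.
have [KR m0 h0 hm hK] := @mesh_bounds R m K K_ge sqrtm_ge.
have K0 : 0 < K%:R :> R by lra.
have v0 : 0 < K%:R^-1 :> R by rewrite invr_gt0.
have v1 : K%:R^-1 <= 100^-1 :> R by rewrite lef_pV2// posrE.
have hm0 : 0 < h / (2 * m%:R) by rewrite divr_gt0//; lra.
have bandE (j : nat) : (j %% K ^ 2)%N = c -> band K j = (c %/ K)%N.
  by rewrite /band => ->.
have sectorE (j : nat) : (j %% K ^ 2)%N = c -> sector K j = (c %% K)%N.
  by rewrite /sector => ->.
have slot_inj (j k : nat) : (j %% K ^ 2)%N = c -> (k %% K ^ 2)%N = c ->
    @grid_row R m K j = @grid_row R m K k -> @grid_col R m K j = @grid_col R m K k -> j = k.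
  move=> jc kc rr cc; apply: (@slot_index_inj K); rewrite ?(bandE j)// ?(bandE k)// ?(sectorE j)// ?(sectorE k)//.
  by rewrite (@grid_row_col R m K j) (@grid_row_col R m K k) rr cc (bandE j)// (bandE k).
set b0 := pi *+ 2 * (c %% K)%:R / K%:R : R.
have m2 (e : 'I_m) : (e < 2 * m)%N by rewrite (leq_trans (ltn_ord e))// leq_pmull.
have inv2 q q' (e e' : 'I_m) : (2 * m * q + e = 2 * m * q' + e')%N -> q = q' /\ e = e'.
  by rewrite !(mulnC (2 * m)%N) => /(muln_add_inj _ _ _ _ _ (m2 e) (m2 e'))[-> /val_inj].
have inv1 q q' (e e' : 'I_m) : (q * m + e = q' * m + e')%N -> q = q' /\ e = e'.
  by move=> /(muln_add_inj _ _ _ _ _ (ltn_ord e) (ltn_ord e'))[-> /val_inj].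
have lab_lt q (e : 'I_m) : (q < 2 * Q)%N -> (q * m + e < 2 * Q * m)%N.
  move=> q2; apply: (@leq_trans (q.+1 * m)); last by rewrite leq_mul2r q2 orbT.
  by rewrite mulSn addnC ltn_add2r.
set A := [pred x : 'I_m * ('I_m * 'I_m) | (x.1 %% K ^ 2 == c)%N && in_slab w x.1 x.2].
have [mer|par] := direction_dichotomy w b0 ww w0 w1.
  (* Slab transverse to the meridians: within the slot the label fixes the longitude exactly, and
     the rank is the colatitude counted in steps. *)
  apply: (@card_le_label_rank _ A (fun x => @grid_col R m K x.1 * m + x.2.2)%N
                              (fun x => 2 * m * @grid_row R m K x.1 + x.2.1)%N).
  - by move=> [j [e g]] _ /=; apply: lab_lt; exact: grid_col_lt.
  - move=> [j [e g]] [k [e' g']]; rewrite !inE /= => /andP[/eqP jc gj] /andP[/eqP kc gk] /inv1[cc gg].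
    rewrite -(ler_nat R) [leRHS]natrD -lerBlDl (le_trans (ler_norm _))// meshQ//.
    have [_ _ _ pj] := @gridpt_cell R m K K_ge sqrtm_ge _ _ _ (ltn_ord j) (ltn_ord e) (ltn_ord g).
    have eqlong : longi m K j g = longi m K k g' :> R.
      by rewrite /longi cc gg (bandE j)// (bandE k)// (sectorE j)// (sectorE k).
    rewrite -[h / _](ger0_norm (ltW hm0)) -normrM mulrBr.
    have dE : colat m K j e - colat m K k e' = h / (2 * m%:R) * (2 * m * @grid_row R m K j + e)%:R -
        h / (2 * m%:R) * (2 * m * @grid_row R m K k + e')%:R.
      by rewrite /colat (bandE j)// (bandE k)//; ring.
    rewrite -dE (_ : 160 / m%:R = 32 * (5 / m%:R)); last by field; rewrite gt_eqF.
    have /andP[rj0 rj1] := row_mesh _ _ K_ge sqrtm_ge _ _ (ltn_ord j) (ltn_ord e).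
    have /andP[rk0 rk1] := row_mesh _ _ K_ge sqrtm_ge _ _ (ltn_ord k) (ltn_ord e').
    have small : (2 * K%:R * s (band K j))^-1 <= 1.
      have [_ _ _ s0 s1] := band_angle_bounds _ _ K_ge sqrtm_ge _ (band_lt _ K_gt0 j).
      have : 1 <= K%:R * s (band K j).
        by rewrite -[leLHS](@divff _ (K%:R : R)) ?gt_eqF// ler_pM2l.
      by move=> ks; rewrite invf_le1; lra.
    rewrite (bandE k)// -(bandE j)// in rk1.
    apply: (@meridian_window R w (longi m K j g) (colat m K j e) (colat m K k e') (5 / m%:R)) => //.
    + apply: mer; rewrite (sectorE j)// -/b0 in pj; case/andP: pj => p1 p2.
      by rewrite ger0_norm; lra.
    + by rewrite eqlong.
    + by rewrite dE ler_norml; apply/andP; split; lra.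
  - move=> [j [e g]] [k [e' g']]; rewrite !inE /= => /andP[/eqP jc gj] /andP[/eqP kc gk] /inv1[cc ->] /inv2[rr ->].
    by congr (_, _); apply: val_inj; exact: slot_inj.
(* Slab transverse to the parallels: the label fixes the colatitude, and the rank is the longitude
   counted in steps. *)
apply: (@card_le_label_rank _ A (fun x => @grid_row R m K x.1 * m + x.2.1)%N
                            (fun x => 2 * m * @grid_col R m K x.1 + x.2.2)%N).
- by move=> [j [e g]] _ /=; apply: lab_lt; exact: grid_row_lt.
- move=> [j [e g]] [k [e' g']]; rewrite !inE /= => /andP[/eqP jc gj] /andP[/eqP kc gk] /inv1[cc gg].
  rewrite -(ler_nat R) [leRHS]natrD -lerBlDl (le_trans (ler_norm _))// meshQ//.
  have [_ sa _ pj] := @gridpt_cell R m K K_ge sqrtm_ge _ _ _ (ltn_ord j) (ltn_ord e) (ltn_ord g).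
  have [_ _ _ pk] := @gridpt_cell R m K K_ge sqrtm_ge _ _ _ (ltn_ord k) (ltn_ord e') (ltn_ord g').
  have eqcol : colat m K j e = colat m K k e' :> R.
    by rewrite /colat cc gg (bandE j)// (bandE k).
  have [_ _ _ s0 s1] := band_angle_bounds _ _ K_ge sqrtm_ge _ (band_lt _ K_gt0 j).
  have sj0 : 0 < s (band K j) by lra.
  have -> : h / (2 * m%:R) * `|(2 * m * @grid_col R m K j + g)%:R -
      (2 * m * @grid_col R m K k + g')%:R| = s (band K j) * `|longi m K j g - longi m K k g'|.
    have -> : longi m K j g - longi m K k g' = h / (2 * m%:R) / s (band K j) *
        ((2 * m * @grid_col R m K j + g)%:R - (2 * m * @grid_col R m K k + g')%:R).
      by rewrite /longi (bandE j)// (bandE k)// (sectorE j)// (sectorE k)//; ring.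
    rewrite normrM [`|_ / s _|]ger0_norm; last by rewrite divr_ge0// ltW.
    by rewrite mulrA (mulrC (s _)) mulfVK// gt_eqF.
  rewrite (_ : 160 / m%:R = 32 * (5 / m%:R)); last by field; rewrite gt_eqF.
  rewrite (sectorE j)// -/b0 in pj; rewrite (sectorE k)// -/b0 in pk.
  case/andP: pj => p1 p2; case/andP: pk => p3 p4.
  apply: (@parallel_window R w _ (colat m K j e)) => //.
  + by apply: par; rewrite ger0_norm; lra.
  + by rewrite eqcol.
  + by rewrite ler_norml; apply/andP; split; lra.
- move=> [j [e g]] [k [e' g']]; rewrite !inE /= => /andP[/eqP jc gj] /andP[/eqP kc gk] /inv1[cc ->] /inv2[rr ->].
  by congr (_, _); apply: val_inj; exact: slot_inj.
Qed.

Lemma slab_count (w : 'rV[R]_3) : 2^-1 <= dot w w ->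
  `|w 0 0| <= 2 -> `|w 0 1| <= 2 ->
  (\sum_(j < m) #|in_slab w j|
    <= K ^ 2 * (2 * Q * m * (1280 * Q).+1))%N.
Proof.
move=> ww w0 w1.
have K20 : (0 < K ^ 2)%N by rewrite expn_gt0 (leq_trans _ K_ge).
pose slot (j : 'I_m) : 'I_(K ^ 2) := Ordinal (ltn_pmod j K20).
rewrite (partition_big slot xpredT)//=.
rewrite -[X in (_ <= X * _)%N](card_ord (K ^ 2)) -sum_nat_const.
apply: leq_sum => c _; apply: leq_trans (slot_count w c ww w0 w1).
rewrite -[leqRHS]sum1_card (eq_bigr (fun j : 'I_m => \sum_(x in in_slab w j) 1)%N); last first.
  by move=> j _; rewrite sum1_card.
by rewrite pair_big_dep/=.
Qed.

End count.

(** * Configurations *)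

(** The cubic lattice of step 1/m in [-1, 1]^3. Its vectors are not normalised, which is why normals
    [w] are only assumed to satisfy [2^-1 <= dot w w]. *)
Definition net_vector (R : realType) (m : nat) (a : {ffun 'I_3 -> 'I_(2 * m).+1}) :
    'rV[R]_3 := \row_i ((a i)%:R / m%:R - 1).

Lemma sphere_coord (R : realType) (u : 'rV[R]_3) i : sphere u -> `|u 0 i| <= 1.
Proof.
rewrite /sphere/= /dot (bigD1 i)//= => e.
have : 0 <= \sum_(j < 3 | j != i) u 0 j * u 0 j.
  by apply: sumr_ge0 => j _; rewrite -expr2 sqr_ge0.
have : `|u 0 i| ^+ 2 = u 0 i * u 0 i by rewrite real_normK ?num_real ?expr2.
by have := normr_ge0 (u 0 i); nra.
Qed.

Lemma net_approx (R : realType) (m : nat) (u : 'rV[R]_3) : (0 < m)%N -> sphere u ->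
  exists a, forall i, `|u 0 i - @net_vector R m a 0 i| <= m%:R^-1.
Proof.
move=> m0 su; have mR : 0 < m%:R :> R by rewrite ltr0n.
exists [ffun i => inord (Num.truncn (m%:R * (u 0 i + 1)))] => i.
rewrite mxE ffunE.
have := sphere_coord _ _ i su; rewrite ler_norml => /andP[u1 u2].
have v0 : 0 <= m%:R * (u 0 i + 1) by rewrite mulr_ge0//; lra.
rewrite inordK; last first.
  rewrite truncn_lt_nat// -natr1 natrM; nra.
have /andP[] := truncn_itv v0; set n := Num.truncn _; rewrite -natr1 => n1 n2.
rewrite -(ler_pM2l mR) -[X in X * _ <= _]ger0_norm ?ltW// -normrM mulfV ?gt_eqF//.
rewrite (_ : m%:R * _ = m%:R * (u 0 i + 1) - n%:R); last by field; rewrite gt_eqF.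
by rewrite ger0_norm; lra.
Qed.

Lemma net_vector_bound (R : realType) (m : nat) a i : (0 < m)%N ->
  `|@net_vector R m a 0 i| <= 2.
Proof.
move=> m0; have mR : 0 < m%:R :> R by rewrite ltr0n.
rewrite mxE ler_norml; apply/andP; split.
  have : 0 <= (a i)%:R / m%:R :> R by rewrite divr_ge0.
  lra.
suff : (a i)%:R / m%:R <= 2 :> R by lra.
by rewrite ler_pdivrMr// -natrM ler_nat -ltnS.
Qed.

Lemma sphere_norm_close (R : realType) (u v : 'rV[R]_3) (d : R) : sphere u ->
  0 <= d <= 100^-1 -> (forall i, `|u 0 i - v 0 i| <= d) -> 2^-1 <= dot v v.
Proof.
move=> su /andP[d0 d1] uv.
have c i : u 0 i * u 0 i - 2 * d <= v 0 i * v 0 i.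
  have := uv i; have := sphere_coord _ _ i su; rewrite !ler_norml.
  move=> /andP[a1 a2] /andP[b1 b2].
  have ue : - d <= u 0 i * (v 0 i - u 0 i).
    have [u0|u0] := leP 0 (u 0 i); nra.
  by have := sqr_ge0 (v 0 i - u 0 i); nra.
move: su; rewrite /sphere/= !dotE.
have c0 : u 0 0 * u 0 0 - 2 * d <= v 0 0 * v 0 0 := c 0.
have c1 : u 0 1 * u 0 1 - 2 * d <= v 0 1 * v 0 1 := c 1.
have c2 : u 0 2%:R * u 0 2%:R - 2 * d <= v 0 2%:R * v 0 2%:R := c 2%:R.
lra.
Qed.

Lemma dot_close (R : realType) (u v x : 'rV[R]_3) (d : R) : sphere x ->
  (forall i, `|u 0 i - v 0 i| <= d) -> `|dot x v| <= `|dot x u| + 3 * d.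
Proof.
move=> sx uv; rewrite -lerBlDl (le_trans (lerB_dist _ _))//.
have c i : `|x 0 i * v 0 i - x 0 i * u 0 i| <= d.
  rewrite -mulrBr normrM distrC.
  have := uv i; have := sphere_coord _ _ i sx.
  by have := normr_ge0 (x 0 i); have := normr_ge0 (u 0 i - v 0 i); nra.
rewrite !dotE.
have : `|x 0 0 * v 0 0 - x 0 0 * u 0 0| <= d := c 0.
have : `|x 0 1 * v 0 1 - x 0 1 * u 0 1| <= d := c 1.
have : `|x 0 2%:R * v 0 2%:R - x 0 2%:R * u 0 2%:R| <= d := c 2%:R.
rewrite !ler_norml.
move=> /andP[a1 a2] /andP[b1 b2] /andP[c1 c2]; apply/andP; split; lra.
Qed.

(* [t ^+ n <= expR (b * l)] bounds [n] by [b * l / ln t], and [t] is at least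
   the square root of [l]. *)
Lemma count_le_log (R : realType) (n : nat) (l t b : R) : 1 < l -> 0 < t ->
  l <= t ^+ 2 -> t ^+ n <= expR (b * l) -> n%:R <= 2 * b * l / ln l.
Proof.
move=> l1 t0 lt tn.
have lnl : 0 < ln l by rewrite ln_gt0.
have l2 : ln l <= 2 * ln t.
  by rewrite mulr_natl -lnXn// ler_ln// posrE ?exprn_gt0//; lra.
have : n%:R * ln t <= b * l.
  by rewrite mulr_natl -lnXn// -[leRHS]expRK ler_ln ?posrE ?expR_gt0 ?exprn_gt0.
have : n%:R * ln l <= n%:R * (2 * ln t) by rewrite ler_wpM2l.
by rewrite ler_pdivlMr//; lra.
Qed.

(** The closed cell, bounded through the cosine of the colatitude: slices of equal height of the
    sphere have equal area. *)
Definition in_cell (R : realType) (K j : nat) (z : R * R) : Prop :=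
  [/\ 0 <= z.1 <= pi,
      1 - (band K j).+1.*2%:R / K%:R <= cos z.1 <= 1 - (band K j).*2%:R / K%:R &
      pi *+ 2 * (sector K j)%:R / K%:R <= z.2 <=
        pi *+ 2 * (sector K j).+1%:R / K%:R].

Definition good_configuration (R : realType) (m K : nat) (p : 'I_m -> 'rV[R]_3) :
    Prop :=
  [/\ forall j : 'I_m, exists2 z, in_cell R K j z & p j = spherical z,
      forall j k : 'I_m, j != k -> 32^-1 / Num.sqrt m%:R <= gdist (p j) (p k) &
      forall G : set 'rV[R]_3, great_circle G ->
        #|[pred j | p j \in neighborhood m%:R^-1 G]|%:R <=
          (22 * 10 ^+ 3) * ln m%:R / ln (ln m%:R) :> R].

Lemma exists_configuration (R : realType) (m K : nat) : (100 <= K)%N ->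
  K%:R ^+ 4 <= ln m%:R :> R -> exists p, good_configuration R m K p.
Proof.
move=> K_ge lnm.
have KR : 100 <= K%:R :> R by rewrite (ler_nat _ 100).
have K4 : 100 ^+ 4 <= K%:R ^+ 4 :> R by rewrite lerXn2r// nnegrE; lra.
have K40 : 0 < K%:R ^+ 4 :> R by rewrite exprn_gt0; lra.
have lnm0 : 100 <= ln m%:R :> R.
  apply: le_trans lnm; apply: le_trans K4.
  by rewrite -[leLHS]expr1 ler_weXn2l//; lra.
have mR : 0 < m%:R :> R.
  by rewrite ltNge; apply/negP => /ln0; lra.
have m0 : (0 < m)%N by rewrite -(ltr_nat R).
have lnlem : ln m%:R <= m%:R :> R.
  by have := expR_ge1Dx (ln (m%:R : R)); rewrite lnK ?posrE//; lra.
have sqrtm_ge : K%:R ^+ 2 <= Num.sqrt m%:R :> R.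
  rewrite -(@ler_pXn2r _ 2)// ?nnegrE ?sqrtr_ge0 ?exprn_ge0// sqr_sqrtr//.
  by rewrite -exprM (le_trans lnm).
have [_ _ h0 hm hK] := @mesh_bounds R m K K_ge sqrtm_ge.
pose Q := (Num.truncn (Num.sqrt m%:R : R)).+1.
have /andP[q1 q2] := truncn_itv (sqrtr_ge0 (m%:R : R)).
have sq : Num.sqrt m%:R ^+ 2 = m%:R :> R by rewrite sqr_sqrtr// ltW.
have S1 : 10 <= Num.sqrt m%:R :> R.
  by apply: le_trans sqrtm_ge; rewrite expr2; nra.
have Q2 : Q%:R ^+ 2 <= 4 * m%:R :> R.
  rewrite -sq /Q -natr1; nra.
have Q_ge : Num.sqrt m%:R <= Q%:R :> R by exact: ltW.
(* Lattice vectors that are too short get an empty bad set, so the mean bound holds for all of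
   them. *)
pose B (a : {ffun 'I_3 -> 'I_(2 * m).+1}) (j : 'I_m) (x : 'I_m * 'I_m) :=
  (2^-1 <= dot (net_vector R m a) (net_vector R m a)) &&
  @in_slab R m K (net_vector R m a) j x.
pose t : R := ln m%:R / K%:R ^+ 2.
have K20 : 0 < K%:R ^+ 2 :> R by rewrite exprn_gt0; lra.
have t2 : ln m%:R <= t ^+ 2.
  rewrite /t expr_div_n -exprM ler_pdivlMr// expr2 ler_wpM2l//; lra.
have t1 : 1 <= t.
  have : 0 <= t by rewrite divr_ge0; lra.
  by move: t2; rewrite expr2; nra.
have [C [C0 CE]] : exists C : R, 0 < C /\ C = 11 * 10 ^+ 3 - 6.
  by exists (11 * 10 ^+ 3 - 6); split=> //; lra.
pose E : R := C * K%:R ^+ 2.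
have E0 : 0 <= E by rewrite mulr_ge0// ltW.
have cardT : #|{: 'I_m * 'I_m}| = (m ^ 2)%N by rewrite card_prod card_ord mulnn.
have cardW : #|{ffun 'I_3 -> 'I_(2 * m).+1}| = ((2 * m).+1 ^ 3)%N.
  by rewrite card_ffun !card_ord.
have mean a : (\sum_j #|B a j|)%N%:R <= E * #|{: 'I_m * 'I_m}|%:R.
  rewrite cardT.
  have [ww|ww] := boolP (2^-1 <= dot (net_vector R m a) (net_vector R m a)); last first.
    rewrite big1; first by rewrite (mulr_ge0 E0).
    by move=> j _; apply: eq_card0 => x; rewrite unfold_in /B (negbTE ww).
  have := @slab_count R m K K_ge sqrtm_ge Q Q_ge _ ww
    (net_vector_bound _ _ _ _ m0) (net_vector_bound _ _ _ _ m0).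
  rewrite -(ler_nat R) (_ : (\sum_(j < m) _)%N = (\sum_j #|B a j|)%N); last first.
    by apply: eq_bigr => j _; apply: eq_card => x; rewrite unfold_in /B ww.
  move=> /le_trans; apply.
  have le : Q%:R * m%:R * (2 * 1280 * Q%:R + 2) <= C * m%:R ^+ 2 :> R.
    rewrite CE; have : 1 <= Q%:R :> R by rewrite (ler_nat _ 1).
    move=> Q1; have : Q%:R * (2 * 1280 * Q%:R + 2) <= (11 * 10 ^+ 3 - 6) * m%:R :> R by nra.
    by rewrite -(ler_pM2r mR) => h; rewrite mulrAC expr2 (mulrA _ m%:R).
  rewrite natrM !natrX /E -mulrA mulrCA ler_pM2l//; apply: le_trans le.
  by rewrite -[(1280 * Q).+1]addn1 !(natrD, natrM); lra.
have [||F HF] := @chernoff_choice R 'I_m _ _ B t E _ _ t1 mean.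
- by rewrite cardT expn_gt0 m0.
- by rewrite cardW expn_gt0.
exists (fun j : 'I_m => gridpt m K j (F j).1 (F j).2); split.
- move=> j; exists (colat m K j (F j).1, longi m K j (F j).2) => //.
  have [t0 _ /andP[c1 c2] /andP[p1 p2]] := @gridpt_cell R m K K_ge sqrtm_ge _ _ _
    (ltn_ord j) (ltn_ord (F j).1) (ltn_ord (F j).2).
  have v0 : 0 < K%:R^-1 :> R by rewrite invr_gt0; lra.
  split => //=; apply/andP; split => //.
    by rewrite (le_trans c2)// lerD2l lerN2 ler_pM2r// ler_nat.
  rewrite (le_trans p2)// -natr1 mulrDr mulr1 mulrDl lerD2l.
  by rewrite -[leLHS]mul1r ler_pM2r// mulr2n; have := pi_ge2 R; lra.
- move=> j k jk.
  have -> : 32^-1 / Num.sqrt m%:R = @mesh R m / 8 by rewrite /mesh invfM; lra.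
  by apply: gridpt_sep => // /val_inj /eqP; apply/negP.
move=> G [u su ->].
have [a ua] := net_approx _ _ _ m0 su.
have iv : m%:R^-1 <= 100^-1 :> R by rewrite lef_pV2 ?posrE//; lra.
have iv0 : 0 < m%:R^-1 :> R by rewrite invr_gt0.
have ww : 2^-1 <= dot (net_vector R m a) (net_vector R m a).
  by apply: (sphere_norm_close _ _ _ _ su _ ua); rewrite iv ltW.
have le : (#|[pred j : 'I_m | gridpt m K j (F j).1 (F j).2 \in
      neighborhood m%:R^-1 [set x | sphere x /\ dot x u = 0%R]]| <=
    #|[pred j | B a j (F j)]|)%N.
  apply: subset_leq_card; apply/fintype.subsetP => j; rewrite !inE.
  move=> /(neighborhood_dot _ _ _ iv0 su) xu.
  rewrite /B ww/= /in_slab.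
  have sx : sphere (@gridpt R m K j (F j).1 (F j).2) by exact: spherical_sphere.
  (* The half-width 5/m is 2/m from the neighborhood plus 3/m from replacing [u] by the net
     vector. *)
  by have := dot_close _ _ _ _ _ sx ua; lra.
apply: (@le_trans _ _ #|[pred j | B a j (F j)]|%:R); first by rewrite ler_nat.
have CE' : 22 * 10 ^+ 3 = 2 * (6 + C) :> R by rewrite CE; lra.
rewrite CE'.
apply: (@count_le_log _ _ _ t) => //; [by rewrite (lt_le_trans _ lnm0)// ltr1n|by rewrite (lt_le_trans _ t1)|].
(* The net contributes m^6 = exp(6 ln m), and the mean contributes exp(t E) with t E = C ln m by the
   choice of [t]. *)
apply: (le_trans (HF a)); rewrite [X in _ <= expR X]mulrDl [leRHS]expRD ler_pM ?expR_ge0//; last first.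
  rewrite ler_expR (_ : C * ln m%:R = t * E); last first.
    by rewrite /t /E [RHS]mulrCA divfK// gt_eqF.
  by rewrite mulrBl mul1r gerBl.
rewrite cardW natrX expRM_natl lnK ?posrE//.
rewrite (_ : m%:R ^+ 6 = (m%:R ^+ 2) ^+ 3); last by rewrite -exprM.
have m100 : 100 <= m%:R :> R by exact: le_trans lnlem.
have m20 : 0 <= m%:R ^+ 2 :> R by rewrite exprn_ge0// ltW.
rewrite lerXn2r ?nnegrE// -natr1 natrM.
by clear -m100; nra.
Qed.

(** * Continuous functions of the angles *)

(** An open set is the union of the rational boxes it contains. Intersecting a box with a constant
    set, full or empty, discards the other boxes while the index type stays countable. *)
Lemma open_measurable_prod (R : realType) (U : set (R * R)) : open U ->
  measurable (U : set (measurableTypeR R * measurableTypeR R)).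
Proof.
move=> oU.
pose box (t : (rat * rat) * (rat * rat)) : set (R * R) :=
  `]ratr t.1.1, ratr t.1.2[ `*` `]ratr t.2.1, ratr t.2.2[.
rewrite (_ : U = \bigcup_t (box t `&` [set _ | box t `<=` U])); last first.
  apply/seteqP; split => [[x y] Uxy|z [t _ [bz bU]]]; last exact: bU.
  have [e /= e0 eU] := (@nbhs_ballP _ _ (x, y) U).1 (open_nbhs_nbhs (conj oU Uxy)).
  have [a ha] := rat_in_itvoo (ltac:(lra) : x - e < x).
  have [b hb] := rat_in_itvoo (ltac:(lra) : x < x + e).
  have [c hc] := rat_in_itvoo (ltac:(lra) : y - e < y).
  have [d hd] := rat_in_itvoo (ltac:(lra) : y < y + e).
  move: ha hb hc hd; rewrite !in_itv/= => /andP[a1 a2] /andP[b1 b2] /andP[c1 c2] /andP[d1 d2].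
  exists ((a, b), (c, d)) => //; split.
    by split; rewrite /= in_itv/=; apply/andP.
  move=> [x' y'] [/=]; rewrite !in_itv/= => /andP[x1 x2] /andP[y1 y2].
  by apply: eU; split; rewrite /ball/= ltr_norml; apply/andP; split; lra.
apply: countable_bigcupT_measurable => [|t]; first exact: countableP.
have [bU|bU] := pselect (box t `<=` U).
  rewrite (_ : [set _ | _] = setT) ?setIT; last by apply/seteqP; split.
  by apply: measurableX; exact: measurable_itv.
rewrite (_ : [set _ | _] = set0) ?setI0//.
by apply/seteqP; split.
Qed.

Lemma continuous_measurable_fun_prod (R : realType) (g : R * R -> R) :
  continuous g ->
  measurable_fun [set: measurableTypeR R * measurableTypeR R] g.
Proof.
move=> cg; apply: (measurability _ (RGenOInfty.measurableE R)).
move=> _ [_ [a ->] <-]; rewrite setTI; apply: open_measurable_prod.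
by move/continuousP : cg; apply; exact: interval_open.
Qed.

Lemma continuous_spherical (R : realType) : continuous (@spherical R).
Proof.
move=> z; apply/cvg_ballP => e e0.
have cf : continuous (fun z : R * R => z.1) by move=> ?; exact: cvg_fst.
have cs : continuous (fun z : R * R => z.2) by move=> ?; exact: cvg_snd.
have sf : continuous (fun z : R * R => sin z.1).
  by move=> x; apply: (continuous_comp (cf x)); exact: continuous_sin.
have kf : continuous (fun z : R * R => cos z.1).
  by move=> x; apply: (continuous_comp (cf x)); exact: continuous_cos.
have ss : continuous (fun z : R * R => sin z.2).
  by move=> x; apply: (continuous_comp (cs x)); exact: continuous_sin.
have ks : continuous (fun z : R * R => cos z.2).
  by move=> x; apply: (continuous_comp (cs x)); exact: continuous_cos.
have c0 : {for z, continuous (fun y : R * R => sin y.1 * cos y.2)}.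
  by apply: cvgM; [exact: sf|exact: ks].
have c1 : {for z, continuous (fun y : R * R => sin y.1 * sin y.2)}.
  by apply: cvgM; [exact: sf|exact: ss].
have c2 := kf z.
move/cvgrPdist_lt/(_ e e0) : c0 => c0.
move/cvgrPdist_lt/(_ e e0) : c1 => c1.
move/cvgrPdist_lt/(_ e e0) : c2 => c2.
near=> y; split=> // i j; rewrite !mxE.
case: j => -[|[|[|//]]] /= _.
- by near: y.
- by near: y.
- by near: y.
Unshelve. all: by end_near. Qed.

(** [f] itself may be discontinuous off the sphere, but near each [z] the composition agrees with
    that of a local continuous extension [F]. *)
Lemma continuous_on_sphere (R : realType) (f : 'rV[R]_3 -> R) :
  smooth_on_sphere f -> continuous (f \o @spherical R).
Proof.
move=> sf z; have [U [F [oU Uz /(_ 0%N)[cF _] Ff]]] := sf _ (spherical_sphere z).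
have cz : {for z, continuous (F \o @spherical R)}.
  apply: continuous_comp; [exact: continuous_spherical|exact: cF].
rewrite /continuous_at /= -(Ff _ Uz (spherical_sphere z)).
apply: cvg_trans cz; apply: near_eq_cvg.
have : \forall y \near z, U (spherical y).
  by apply: (continuous_spherical R z); exact: open_nbhs_nbhs.
apply: filterS => y Uy /=.
by rewrite Ff//; exact: spherical_sphere.
Qed.

Definition angle_box (R : realType) : set (R * R) := `[0, pi] `*` `[0, pi *+ 2].

Lemma compact_angle_box (R : realType) : compact (angle_box R).
Proof. by apply: compact_setX; exact: segment_compact. Qed.

(** Heine-Cantor, through the covering form of compactness with [d] tending to 0 from the right. *)
Lemma uniform_on_box (R : realType) (g : R * R -> R) (e : R) : 0 < e -> continuous g ->
  exists2 d : R, 0 < d & forall z z' : R * R, angle_box R z ->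
    `|z.1 - z'.1| <= d -> `|z.2 - z'.2| <= d -> `|g z - g z'| <= e.
Proof.
move=> e0 cg.
have /compact_near_coveringP := compact_angle_box R.
move=> /(_ R (0^'+) (fun d z => forall z' : R * R,
  `|z.1 - z'.1| <= d -> `|z.2 - z'.2| <= d -> `|g z - g z'| <= e)) [].
  move=> x _.
  have /cvgrPdist_lt /(_ (e / 2)) := cg x.
  rewrite divr_gt0// => /(_ isT) /nbhs_ballP[r /= r0 xr].
  exists (ball x (r / 2), [set d : R | 0 < d < r / 2]) => /=.
    split; first by apply: nbhsx_ballx; rewrite divr_gt0.
    near=> d; apply/andP; split => //.
    by near: d; apply: nbhs_right_lt; rewrite divr_gt0.
  move=> [z d] [/= [z1 z2] /andP[d0 dr]] z' h1 h2.
  have bz : ball x r z.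
    by split; apply: le_ball; [|exact: z1| |exact: z2]; lra.
  have bz' : ball x r z'.
    move: z1 z2; rewrite /ball/= => z1 z2.
    split; rewrite /ball/=.
      rewrite (_ : x.1 - z'.1 = (x.1 - z.1) + (z.1 - z'.1)); last by ring.
      by rewrite (le_lt_trans (ler_normD _ _))//; lra.
    rewrite (_ : x.2 - z'.2 = (x.2 - z.2) + (z.2 - z'.2)); last by ring.
    by rewrite (le_lt_trans (ler_normD _ _))//; lra.
  have := xr _ bz; have := xr _ bz'; rewrite /ball/= => b1 b2.
  rewrite (_ : g z - g z' = (g x - g z') - (g x - g z)); last by ring.
  by rewrite (le_trans (ler_normB _ _))//; lra.
move=> d0 /= d0_gt0 h; exists (d0 / 2); first by rewrite divr_gt0.
move=> z z' bz h1 h2.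
apply: (h (d0 / 2) _ _ z bz z' h1 h2) => /=; last by rewrite divr_gt0.
by rewrite sub0r normrN ger0_norm; lra.
Unshelve. all: by end_near. Qed.

(** * Integration over cells *)

Section cells.
Context {R : realType}.
Notation leb := (@lebesgue_measure R).
Notation M := (leb \x leb)%E.

Lemma integral_sin_itv (a b k : R) : a < b ->
  (\int[leb]_(x in `[a, b[) (sin x * k)%:E = ((cos a - cos b) * k)%:E)%E.
Proof.
move=> ab.
have cont (h : R -> R) : continuous h -> {within `[a, b], continuous h}.
  by move=> ch; exact: continuous_subspaceT.
have csin : continuous (fun x : R => sin x * k).
  by move=> x; apply: cvgM; [exact: continuous_sin|exact: cvg_cst].
have ccos : continuous (fun x : R => - cos x * k).
  by move=> x; apply: cvgM; [apply: cvgN; exact: continuous_cos|exact: cvg_cst].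
have dF (x : R) : is_derive x (1 : R) (fun x : R => - cos x * k) (sin x * k).
  apply: is_derive_eq.
  by rewrite scaler0 add0r opprK [LHS]mulrC.
rewrite integral_itv_bndo_bndc; last first.
  by apply/measurable_EFinP; apply: measurable_funTS; exact: continuous_measurable_fun.
rewrite (@continuous_FTC2 R _ (fun x => - cos x * k))//.
- by rewrite -EFinB; congr _%:E; ring.
- exact: cont.
- split.
  + by move=> x _; exact: (@ex_derive _ _ _ _ _ _ _ (dF x)).
  + by apply: cvg_at_right_filter; exact: ccos.
  + by apply: cvg_at_left_filter; exact: ccos.
- by move=> x _; rewrite derive1E (@derive_val _ _ _ _ _ _ _ (dF x)).
Qed.

Lemma integral_sin_rect (a b c d : R) : 0 <= a -> a < b -> b <= pi -> c <= d ->
  (\int[M]_(z in `[a, b[ `*` `[c, d[) (sin z.1)%:E =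
    ((cos a - cos b) * (d - c))%:E)%E.
Proof.
move=> a0 ab bpi cd.
have mrect : measurable (`[a, b[ `*` `[c, d[ : set (R * R)).
  by apply: measurableX; exact: measurable_itv.
rewrite integral_mkcond fubini_tonelli1; first last.
- move=> [x y]; rewrite patchE; case: ifPn => // /set_mem[/=].
  rewrite in_itv/= => /andP[x1 x2] _; rewrite lee_fin sin_ge0_pi//.
  by rewrite (le_trans a0)//= (le_trans (ltW x2)).
- apply/(measurable_restrictT _ _).1 => //; apply/measurable_EFinP.
  apply: measurable_funTS; apply: measurableT_comp => //.
  by apply: continuous_measurable_fun; exact: continuous_sin.
rewrite -integral_sin_itv// [RHS]integral_mkcond; apply: eq_integral => x _.
rewrite /fubini_F !patchE; case: ifPn => xab.
  transitivity (\int[leb]_(y in `[c, d[) (sin x)%:E)%E.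
    rewrite [RHS]integral_mkcond; apply: eq_integral => y _.
    by rewrite !patchE in_setX xab.
  rewrite integral_cst//= lebesgue_measure_itv/= lte_fin.
  by case: ltgtP cd => // -> _; rewrite subrr mulr0 mule0.
rewrite integral0_eq// => y _; rewrite patchE; case: ifPn => // /set_mem[/= xab' _].
by move: xab; rewrite mem_set.
Qed.

Definition colat_cut (K i : nat) : R := acos (1 - i.*2%:R / K%:R).
Definition longi_cut (K l : nat) : R := pi *+ 2 * l%:R / K%:R.
(** Half-open, unlike [in_cell], so that the cells are disjoint and cover the box up to two
    edges. *)
Definition cell (K s : nat) : set (R * R) :=
  `[colat_cut K (band K s), colat_cut K (band K s).+1[ `*`
  `[longi_cut K (sector K s), longi_cut K (sector K s).+1[.

Lemma colat_cut_spec K i : (0 < K)%N -> (i <= K)%N ->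
  0 <= colat_cut K i <= pi /\ cos (colat_cut K i) = 1 - i.*2%:R / K%:R.
Proof.
move=> K0 iK; have KR : 0 < K%:R :> R by rewrite ltr0n.
have b : -1 <= 1 - (i.*2%:R : R) / K%:R <= 1.
  have h0 : 0 <= i.*2%:R / K%:R :> R by rewrite divr_ge0.
  have h2 : i.*2%:R / K%:R <= 2 :> R.
    by rewrite ler_pdivrMr// -natrM ler_nat mul2n leq_double.
  by apply/andP; split; lra.
by split; [rewrite /colat_cut acos_ge0// acos_lepi|rewrite acosK// in_itv].
Qed.

Lemma colat_cut_lt K i : (i < K)%N -> colat_cut K i < colat_cut K i.+1.
Proof.
move=> iK; have K0 : (0 < K)%N by exact: leq_ltn_trans iK.
have [i1 i2] := colat_cut_spec _ _ K0 (ltnW iK).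
have [j1 j2] := colat_cut_spec _ _ K0 iK.
rewrite -ltr_cos ?in_itv//= i2 j2 ltrD2l ltrN2 ltr_pM2r ?invr_gt0 ?ltr0n//.
by rewrite ltr_nat ltn_double.
Qed.

Lemma cell_cos K s z : (s < K ^ 2)%N -> cell K s z ->
  [/\ 0 <= z.1 <= pi,
      1 - (band K s).+1.*2%:R / K%:R < cos z.1 <= 1 - (band K s).*2%:R / K%:R &
      longi_cut K (sector K s) <= z.2 < longi_cut K (sector K s).+1].
Proof.
move=> sK [/=]; rewrite !in_itv/= => /andP[z1 z2] z3.
have bK := slot_band_lt _ _ sK; have K0 : (0 < K)%N by exact: leq_ltn_trans bK.
have [/andP[i0 ipi] i2] := colat_cut_spec _ _ K0 (ltnW bK).
have [/andP[j0 jpi] j2] := colat_cut_spec _ _ K0 bK.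
have zb : 0 <= z.1 <= pi by rewrite (le_trans i0)//= (le_trans (ltW z2)).
split=> //; rewrite -i2 -j2; apply/andP; split.
  by rewrite ltr_cos// in_itv/= j0.
by rewrite leNgt ltr_cos ?in_itv//= ?i0// -leNgt.
Qed.

Lemma cell_in_cell K s z : (s < K ^ 2)%N -> cell K s z -> in_cell R K s z.
Proof.
move=> sK /(cell_cos _ _ _ sK)[h1 /andP[h2 h3] /andP[h4 h5]]; split=> //.
  by rewrite h3 ltW.
by rewrite h4 ltW.
Qed.

(** The inverse of the numbering of cells, by truncation. That a point determines its cell yields
    disjointness, and that its value is a valid cell yields covering. *)
Definition cell_index (K : nat) (z : R * R) : nat :=
  (Num.truncn (K%:R * (1 - cos z.1) / 2) * K +
   Num.truncn (K%:R * z.2 / (pi *+ 2)))%N.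

Lemma band_sector_digits K i l : (i < K)%N -> (l < K)%N ->
  band K (i * K + l) = i /\ sector K (i * K + l) = l.
Proof.
move=> iK lK; have K0 : (0 < K)%N by exact: leq_ltn_trans iK.
have lt : (i * K + l < K ^ 2)%N.
  by rewrite -mulnn (@leq_trans (i.+1 * K))// ?leq_mul2r ?iK ?orbT// mulSn addnC ltn_add2r.
rewrite /band /sector (modn_small lt) divnMDl// modnMDl divn_small// modn_small//.
by rewrite addn0.
Qed.

Lemma cell_indexP K s z : (s < K ^ 2)%N -> cell K s z -> s = cell_index K z.
Proof.
move=> sK /(cell_cos _ _ _ sK)[_ /andP[c1 c2] /andP[d1 d2]].
have bK := slot_band_lt _ _ sK; have K0 : (0 < K)%N by exact: leq_ltn_trans bK.
have KR : 0 < K%:R :> R by rewrite ltr0n.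
have p0 : 0 < pi *+ 2 :> R by rewrite mulrn_wgt0// pi_gt0.
rewrite /cell_index (@truncn_def _ _ (band K s)); last first.
  rewrite ler_pdivlMr// ltr_pdivrMr//.
  move: c1 c2; rewrite ltrBlDr -ltrBlDl ltr_pdivlMr// lerBrDr -lerBrDl ler_pdivrMr//.
  rewrite -!muln2 !natrM => c1 c2.
  by apply/andP; split; lra.
rewrite (@truncn_def _ _ (sector K s)); last first.
  rewrite ler_pdivlMr// ltr_pdivrMr//.
  move: d1 d2; rewrite /longi_cut ler_pdivrMr// ltr_pdivlMr// => d1 d2.
  by rewrite -!(mulrC (pi *+ 2)) (mulrC K%:R) d1 d2.
by rewrite /band /sector modn_small// -divn_eq.
Qed.

Lemma cell_index_cell K z : (0 < K)%N -> 0 <= z.1 < pi -> 0 <= z.2 < pi *+ 2 ->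
  (cell_index K z < K ^ 2)%N /\ cell K (cell_index K z) z.
Proof.
move=> K0 /andP[a0 a1] /andP[b0 b1].
have KR : 0 < K%:R :> R by rewrite ltr0n.
have p0 : 0 < pi *+ 2 :> R by rewrite mulrn_wgt0// pi_gt0.
rewrite /cell_index.
have cgt : - 1 < cos z.1.
  by rewrite -cospi ltr_cos ?in_itv/= ?a0 ?(ltW a1) ?pi_ge0 ?lexx.
have x0 : 0 <= K%:R * (1 - cos z.1) / 2.
  by rewrite divr_ge0// mulr_ge0 ?ler0n// subr_ge0 cos_le1.
have y0 : 0 <= K%:R * z.2 / (pi *+ 2) by rewrite divr_ge0 ?mulr_ge0// ltW.
have iK : (Num.truncn (K%:R * (1 - cos z.1) / 2) < K)%N.
  by rewrite truncn_lt_nat// ltr_pdivrMr// ltr_pM2l//; lra.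
have lK : (Num.truncn (K%:R * z.2 / (pi *+ 2)) < K)%N.
  by rewrite truncn_lt_nat// ltr_pdivrMr// ltr_pM2l.
have /andP[i1 i2] := truncn_itv x0; have /andP[l1 l2] := truncn_itv y0.
set i := Num.truncn _ in iK i1 i2 *; set l := Num.truncn _ in lK l1 l2 *.
have [bE sE] := band_sector_digits _ _ _ iK lK.
split.
  by rewrite -mulnn (@leq_trans (i.+1 * K))// ?leq_mul2r ?iK ?orbT// mulSn addnC ltn_add2r.
split; rewrite /= in_itv/= ?bE ?sE; last first.
  rewrite /longi_cut ler_pdivrMr// ltr_pdivlMr//.
  by move: l1 l2; rewrite ler_pdivlMr// ltr_pdivrMr// !(mulrC (pi *+ 2)) (mulrC z.2) => -> ->.
have [/andP[s0 spi] s2] := colat_cut_spec _ _ K0 (ltnW iK).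
have [/andP[t0 tpi] t2] := colat_cut_spec _ _ K0 iK.
have zin : z.1 \in `[0, pi] by rewrite in_itv/= a0 ltW.
move: i1 i2; rewrite ler_pdivlMr// ltr_pdivrMr// => i1 i2.
apply/andP; split.
  rewrite leNgt -ltr_cos ?in_itv//= ?s0// -leNgt s2 lerBrDr -lerBrDl ler_pdivrMr//.
  by rewrite -muln2 natrM; lra.
rewrite -ltr_cos ?in_itv//= ?t0// t2 ltrBlDr -ltrBlDl ltr_pdivlMr//.
by rewrite -muln2 natrM; lra.
Qed.

End cells.

(** * Riemann sums with equal weights on the box of angles *)

Section box_integral.
Context {R : realType}.
Notation leb := (@lebesgue_measure R).
Notation M := (leb \x leb)%E.
Notation box := (angle_box R).

Lemma measurable_box :
  measurable (box : set (measurableTypeR R * measurableTypeR R)).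
Proof. by apply: measurableX; exact: measurable_itv. Qed.

Lemma measurable_cell K s :
  measurable (cell K s : set (measurableTypeR R * measurableTypeR R)).
Proof. by apply: measurableX; exact: measurable_itv. Qed.

Lemma box_bounded (g : R * R -> R) : continuous g ->
  exists2 B : R, 0 <= B & forall z, box z -> `|g z| <= B.
Proof.
move=> cg; have [B [_ hB]] := compact_bounded (continuous_compact
  (continuous_subspaceT cg) (compact_angle_box R)).
exists (`|B| + 1); first by rewrite addr_ge0.
move=> z bz; apply: (hB (`|B| + 1)); last by exists z.
by rewrite ltr_pwDr// ler_norm.
Qed.

Lemma box_integrable (g : R * R -> R) : continuous g -> M.-integrable box (EFin \o g).
Proof.
move=> cg; apply: measurable_bounded_integrable.
- exact: measurable_box.
- rewrite [ltLHS](_ : _ = (leb (`[0%R, pi] : set R) * leb (`[0%R, (pi *+ 2)%R] : set R))%E); last first.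
    by apply: product_measure1E; exact: measurable_itv.
  rewrite !lebesgue_measure_itv/= !lte_fin pi_gt0 mulrn_wgt0 ?pi_gt0//.
  by rewrite -!EFinB -EFinM ltry.
- by apply: measurable_funTS; exact: continuous_measurable_fun_prod.
- have [B B0 hB] := box_bounded _ cg.
  exists B; split; first exact: num_real.
  move=> x Bx z bz; apply: (le_trans (hB _ bz)); exact: ltW.
Qed.

Lemma cell_box K s : (s < K ^ 2)%N -> @cell R K s `<=` box.
Proof.
move=> sK z /(cell_cos _ _ _ sK)[h1 _ /andP[h2 h3]].
have KR : 0 < K%:R :> R by rewrite ltr0n; case: K sK {h1 h2 h3}.
have p0 : 0 < pi *+ 2 :> R by rewrite mulrn_wgt0// pi_gt0.
have sl : (sector K s < K)%N by rewrite ltn_pmod// -(ltr0n R).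
split; rewrite /= in_itv//=; apply/andP; split.
  by apply: le_trans h2; rewrite /longi_cut divr_ge0// mulr_ge0// ltW.
by rewrite (le_trans (ltW h3))// /longi_cut ler_pdivrMr// ler_pM2l// ler_nat.
Qed.

Lemma cell_integrable K s (g : R * R -> R) : (s < K ^ 2)%N -> continuous g ->
  M.-integrable (cell K s) (EFin \o g).
Proof.
move=> sK cg; apply: (integrableS measurable_box (measurable_cell K s) (cell_box _ _ sK)).
exact: box_integrable.

Qed.

Let far_edges : set (R * R) := [set pi] `*` setT `|` setT `*` [set (pi *+ 2 : R)].

Let measurable_far_edges :
  measurable (far_edges : set (measurableTypeR R * measurableTypeR R)).
Proof. by apply: measurableU; apply: measurableX. Qed.

Let far_edges0 : M far_edges = 0%E.
Proof.
apply/eqP; rewrite eq_le measure_ge0 andbT.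
apply: (le_trans (measureU2 _ _ _)); [by apply: measurableX|by apply: measurableX|].
rewrite [X in (X + _)%E](_ : _ = (leb [set (pi : R)%R] * leb setT)%E); last first.
  exact: product_measure1E.
rewrite [X in (_ + X)%E](_ : _ = (leb setT * leb [set (pi *+ 2 : R)%R])%E); last first.
  exact: product_measure1E.
by rewrite !lebesgue_measure_set1 mul0e mule0 adde0.
Qed.

Let box_cells K : (0 < K)%N ->
  box `\` far_edges = \big[setU/set0]_(s < K ^ 2) @cell R K s.
Proof.
move=> K0; rewrite -bigcup_mkord; apply/seteqP; split => [z [[/= z1 z2] nz]|z [s /= sK cz]].
  move: z1 z2; rewrite !in_itv/= => /andP[a0 a1] /andP[b0 b1].
  have az : z.1 < pi.
    by rewrite lt_neqAle a1 andbT; apply/eqP => e; apply: nz; left.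
  have bz : z.2 < pi *+ 2.
    by rewrite lt_neqAle b1 andbT; apply/eqP => e; apply: nz; right.
  have [] := cell_index_cell K z K0; [by rewrite a0|by rewrite b0|].
  by exists (cell_index K z).
split; first exact: cell_box cz.
have sl : (sector K s < K)%N by rewrite ltn_pmod.
move=> [] -[/=].
  move=> e _; have [/= _ /andP[]] := cell_cos _ _ _ sK cz.
  rewrite e cospi => + _ _; have KR : 0 < K%:R :> R by rewrite ltr0n.
  rewrite ltrBlDr -ltrBlDl ltr_pdivlMr// => h.
  have : (K.*2)%:R < (band K s).+1.*2%:R :> R by rewrite -muln2 natrM; lra.
  by rewrite ltr_nat ltn_double ltnS leqNgt (slot_band_lt _ _ sK).
move=> _ e; have [/= _ _ /andP[_]] := cell_cos _ _ _ sK cz.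
have KR : 0 < K%:R :> R by rewrite ltr0n.
have p0 : 0 < pi *+ 2 :> R by rewrite mulrn_wgt0// pi_gt0.
rewrite e /longi_cut ltr_pdivlMr// (ltr_pM2l p0).
by rewrite ltr_nat ltnS leqNgt sl.
Qed.

Lemma integral_box_cells K (g : R * R -> R) : (0 < K)%N -> continuous g ->
  \int[M]_(z in box) g z = \sum_(s < K ^ 2) \int[M]_(z in cell K s) g z.
Proof.
move=> K0 cg.
rewrite /Rintegral (negligible_integral measurable_far_edges measurable_box)//; last first.
  exact: box_integrable.
rewrite (box_cells K K0) integral_bigsetU_EFin; first last.
- by apply/measurable_EFinP; apply: measurable_funTS; exact: continuous_measurable_fun_prod.
- move=> s t _ _ [z [cs ct]]; apply: val_inj.
  exact: etrans (cell_indexP _ _ _ (ltn_ord s) cs) (esym (cell_indexP _ _ _ (ltn_ord t) ct)).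
- exact: index_enum_uniq.
- by move=> s; exact: measurable_cell.
rewrite sum_fine//= => s _.
by apply: integrable_fin_num; [exact: measurable_cell|exact: cell_integrable].
Qed.

(** Archimedes: the area is the height 2/K of the slice times the longitude width 2 pi/K. *)
Lemma cell_weight K s : (s < K ^ 2)%N ->
  \int[M]_(z in cell K s) sin z.1 = 4 * pi / K%:R ^+ 2.
Proof.
move=> sK; have bK := slot_band_lt _ _ sK; have K0 : (0 < K)%N by exact: leq_ltn_trans bK.
have KR : 0 < K%:R :> R by rewrite ltr0n.
have [/andP[i0 ipi] i2] := @colat_cut_spec R _ _ K0 (ltnW bK).
have [/andP[j0 jpi] j2] := @colat_cut_spec R _ _ K0 bK.
rewrite /Rintegral integral_sin_rect//=; last 2 first.
- exact: colat_cut_lt.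
- rewrite /longi_cut ler_pM2r ?invr_gt0// ler_pM2l ?ler_nat//.
  by rewrite mulrn_wgt0// pi_gt0.
rewrite i2 j2 /longi_cut doubleS -!natr1 -mulr_natl.
by field; rewrite gt_eqF.
Qed.

Lemma integral_cell_approx K (g : R * R -> R) (c : nat -> R) (e : R) :
  (0 < K)%N -> continuous g ->
  (forall s z, (s < K ^ 2)%N -> cell K s z -> `|g z - c s| <= e) ->
  `|\int[M]_(z in box) (g z * sin z.1) - 4 * pi / K%:R ^+ 2 * \sum_(s < K ^ 2) c s|
    <= 4 * pi * e.
Proof.
move=> K0 cg gc; have KR : 0 < K%:R :> R by rewrite ltr0n.
have csin : continuous (fun z : R * R => sin z.1).
  by move=> x; apply: (continuous_comp cvg_fst); exact: continuous_sin.
have cgs : continuous (fun z : R * R => g z * sin z.1).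
  by move=> x; apply: cvgM; [exact: cg|exact: csin].
have ccst (k : R) : continuous (fun z : R * R => k * sin z.1).
  by move=> x; apply: cvgM; [exact: cvg_cst|exact: csin].
rewrite (integral_box_cells K)// mulr_sumr -sumrB.
apply: (le_trans (ler_norm_sum _ _ _)).
apply: (@le_trans _ _ (\sum_(s < K ^ 2) e * (4 * pi / K%:R ^+ 2))); last first.
  rewrite sumr_const card_ord -[leLHS]mulr_natr natrX.
  have -> : e * (4 * pi / K%:R ^+ 2) * K%:R ^+ 2 = 4 * pi * e by field; rewrite gt_eqF.
  exact: lexx.
apply: ler_sum => s _; have sK := ltn_ord s.
have isin := cell_integrable K s _ sK csin.
rewrite -(cell_weight K s sK) (mulrC _ (c s)).
rewrite -(RintegralZl (c s) (measurable_cell K s) isin).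
rewrite -RintegralB//; [|exact: measurable_cell|exact: cell_integrable|exact: cell_integrable].
rewrite -(RintegralZl e (measurable_cell K s) isin).
apply: (le_trans (le_normr_Rintegral _ _)); first exact: measurable_cell.
  apply: (cell_integrable K s (fun z => g z * sin z.1 - c s * sin z.1)) => // x.
  by apply: cvgB; [exact: cgs|exact: ccst].
apply: le_Rintegral; first exact: measurable_cell.
- apply: (cell_integrable K s (fun z => `|g z * sin z.1 - c s * sin z.1|)) => // x.
  by apply: cvg_norm; apply: cvgB; [exact: cgs|exact: ccst].
- exact: cell_integrable.
- move=> z cz; have [zb _ _] := cell_cos _ _ _ sK cz.
  rewrite -mulrBl normrM [`|sin _|]ger0_norm ?sin_ge0_pi//.
  by rewrite ler_wpM2r ?sin_ge0_pi// gc.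
Qed.

End box_integral.

(** * Averages over indices dealt cyclically to the slots *)

Lemma sum_mod (R : pzRingType) (L q : nat) (c : nat -> R) : (0 < L)%N ->
  \sum_(0 <= j < q * L) c (j %% L)%N = q%:R * \sum_(s < L) c s.
Proof.
move=> L0; elim: q => [|q IH]; first by rewrite mul0n big_geq// mul0r.
rewrite mulSnr (big_cat_nat _ (n := (q * L)%N))//= ?leq_addr// IH -natr1 mulrDl mul1r.
congr (_ + _); rewrite -{1}[(q * L)%N]add0n big_addn addKn big_mkord.
by apply: eq_bigr => s _; rewrite addnC modnMDl modn_small.
Qed.

(** Complete rounds through the L slots reproduce the average of [c] exactly. The incomplete last
    round costs at most L B, and so does the remainder of m modulo L in the normalisation. *)
Lemma average_mod (R : realType) (m L : nat) (v : 'I_m -> R) (c : nat -> R) (e B : R) :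
  (0 < L)%N -> (0 < m)%N ->
  (forall j : 'I_m, `|v j - c (j %% L)%N| <= e) ->
  (forall s, (s < L)%N -> `|c s| <= B) ->
  `|m%:R^-1 * \sum_j v j - L%:R^-1 * \sum_(s < L) c s| <= e + 2 * B * L%:R / m%:R.
Proof.
move=> L0 m0 vc cB; set S := \sum_(s < L) c s.
have mR : 0 < m%:R :> R by rewrite ltr0n.
have LR : 0 < L%:R :> R by rewrite ltr0n.
have B0 : 0 <= B by exact: le_trans (cB _ L0).
have close : `|\sum_j v j - \sum_(j < m) c (j %% L)%N| <= e * m%:R.
  rewrite -sumrB (le_trans (ler_norm_sum _ _ _))//.
  rewrite (@le_trans _ _ (\sum_(j < m) e))//; first by apply: ler_sum => j _; exact: vc.
  by rewrite sumr_const card_ord mulr_natr.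
have split : \sum_(j < m) c (j %% L)%N = (m %/ L)%:R * S +
    \sum_((m %/ L * L)%N <= j < m) c (j %% L)%N.
  rewrite -(big_mkord xpredT (fun j => c (j %% L)%N)).
  by rewrite (big_cat_nat _ (n := (m %/ L * L)%N))//= ?leq_trunc_div// sum_mod.
set T := \sum_(_ <= j < m) _ in split.
have r0 : (m %% L)%:R <= L%:R :> R by rewrite ler_nat ltnW// ltn_pmod.
have TB : `|T| <= (m %% L)%:R * B.
  rewrite /T (le_trans (ler_norm_sum _ _ _))//.
  rewrite (@le_trans _ _ (\sum_((m %/ L * L)%N <= j < m) B))//.
    by apply: ler_sum => j _; apply: cB; exact: ltn_pmod.
  by rewrite sumr_const_nat {1}(divn_eq m L) addKn mulr_natl.
have SB : `|S| <= L%:R * B.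
  rewrite /S (le_trans (ler_norm_sum _ _ _))//.
  rewrite (@le_trans _ _ (\sum_(s < L) B))//; first by apply: ler_sum => s _; exact: cB.
  by rewrite sumr_const card_ord mulr_natl.
have mE : m%:R = (m %/ L)%:R * L%:R + (m %% L)%:R :> R by rewrite -natrM -natrD -divn_eq.
have key : `|L%:R * (\sum_(j < m) c (j %% L)%N) - m%:R * S| <= 2 * B * L%:R ^+ 2.
  rewrite split mE (_ : _ - _ = L%:R * T - (m %% L)%:R * S); last ring.
  rewrite (le_trans (ler_normB _ _))// !normrM ![`|_%:R|]ger0_norm//.
  have h1 : L%:R * `|T| <= L%:R * (L%:R * B).
    by rewrite ler_pM2l// (le_trans TB)// ler_wpM2r.
  have h2 : (m %% L)%:R * `|S| <= L%:R * (L%:R * B) by exact: ler_pM.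
  by rewrite expr2; lra.
rewrite (_ : _ - _ = m%:R^-1 * ((\sum_j v j - \sum_(j < m) c (j %% L)%N) +
   L%:R^-1 * (L%:R * (\sum_(j < m) c (j %% L)%N) - m%:R * S))); last first.
  by field; rewrite !gt_eqF.
rewrite normrM ger0_norm ?invr_ge0// mulrC ler_pdivrMr// mulrDl divfK ?gt_eqF//.
rewrite (le_trans (ler_normD _ _))// lerD// normrM ger0_norm ?invr_ge0//.
rewrite ler_pdivrMl// (le_trans key)//.
by have -> : 2 * B * L%:R ^+ 2 = L%:R * (2 * B * L%:R) by ring.
Qed.

(** * Equidistribution *)

(** The difference of cosines is 2 sin((a + b)/2) sin((b - a)/2), and both arguments stay (b - a)/4
    away from 0 and pi, so each sine is at least (b - a)/8. The square is forced by the poles, where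
    a band of height 2/K has colatitude width of order K^(-1/2). *)
Lemma sqr_dist_le_cos (R : realType) (a b : R) : 0 <= a <= pi -> 0 <= b <= pi ->
  (a - b) ^+ 2 <= 32 * `|cos a - cos b|.
Proof.
wlog ab : a b / a <= b.
  move=> wl ha hb; have [ab|ba] := leP a b; first exact: wl.
  by rewrite -sqrrN opprB distrC; apply: wl => //; exact: ltW.
move=> /andP[a0 ap] /andP[b0 bp]; have pi4 := @pi_le4 R; have pi2 := pi_ge2 R.
have -> : cos a - cos b = 2 * (sin ((a + b) / 2) * sin ((b - a) / 2)).
  rewrite [X in cos X - _](_ : _ = (a + b) / 2 - (b - a) / 2); last lra.
  rewrite [X in _ - cos X = _](_ : _ = (a + b) / 2 + (b - a) / 2); last lra.
  by rewrite !(cosD, cosN, sinN); ring.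
have s1 : (b - a) / 4 / 2 <= sin ((a + b) / 2).
  by apply: sin_ge_margin; apply/andP; split; lra.
have s2 : (b - a) / 4 / 2 <= sin ((b - a) / 2).
  by apply: sin_ge_margin; apply/andP; split; lra.
rewrite (le_trans _ (ler_wpM2l _ (ler_norm _)))//.
have : (b - a) / 4 / 2 * ((b - a) / 4 / 2) <= sin ((a + b) / 2) * sin ((b - a) / 2).
  by apply: ler_pM => //; lra.
by nra.
Qed.

Lemma in_cell_box (R : realType) K s z : (0 < K)%N -> in_cell R K s z -> angle_box R z.
Proof.
move=> K0 [zb _ /andP[p1 p2]].
have KR : 0 < K%:R :> R by rewrite ltr0n.
have p0 : 0 < pi *+ 2 :> R by rewrite mulrn_wgt0// pi_gt0.
have sl : (sector K s < K)%N by rewrite ltn_pmod.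
split; rewrite /= in_itv//=; apply/andP; split.
  by apply: le_trans p1; rewrite divr_ge0// mulr_ge0// ltW.
by rewrite (le_trans p2)// ler_pdivrMr// (ler_pM2l p0) ler_nat.
Qed.

Lemma in_cell_close (R : realType) K s z z' : (0 < K)%N ->
  in_cell R K s z -> in_cell R K s z' ->
  (z.1 - z'.1) ^+ 2 <= 64 / K%:R /\ `|z.2 - z'.2| <= 8 / K%:R.
Proof.
move=> K0 [zb /andP[c1 c2] /andP[p1 p2]] [zb' /andP[c1' c2'] /andP[p1' p2']].
have KR : 0 < K%:R :> R by rewrite ltr0n.
have v0 : 0 < K%:R^-1 :> R by rewrite invr_gt0.
split.
  apply: (le_trans (sqr_dist_le_cos _ _ _ zb zb')).
  have : `|cos z.1 - cos z'.1| <= 2 / K%:R.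
    have eK : (band K s).+1.*2%:R / K%:R = (band K s).*2%:R / K%:R + 2 / K%:R :> R.
      by rewrite doubleS -addn2 natrD mulrDl.
    rewrite eK in c1 c1'.
    by rewrite ler_norml; apply/andP; split; lra.
  by lra.
have -> : 8 / K%:R = 4 * 2 / K%:R :> R by lra.
have pi4 := @pi_le4 R; have pi0 := pi_ge0 R.
have eS : pi *+ 2 * (sector K s).+1%:R / K%:R =
    pi *+ 2 * (sector K s)%:R / K%:R + pi *+ 2 / K%:R :> R.
  by rewrite -[(sector K s).+1%:R]natr1 mulrDr mulr1 mulrDl.
rewrite eS in p2 p2'.
have : pi *+ 2 / K%:R <= 4 * 2 / K%:R :> R by rewrite ler_pM2r// mulr2n; lra.
by move=> h; rewrite ler_norml; apply/andP; split; lra.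
Qed.

Lemma equidistribution (R : realType) (M : nat) (K : nat -> nat)
    (p : forall m : nat, 'I_m -> 'rV[R]_3) (f : 'rV[R]_3 -> R) :
  (forall m, (M <= m)%N -> (0 < K m)%N /\ (K m ^ 4 <= m)%N) ->
  (forall k, \forall m \near \oo, (k <= K m)%N) ->
  (forall m, (M <= m)%N -> forall j : 'I_m,
    exists2 z, in_cell R (K m) j z & p m j = spherical z) ->
  smooth_on_sphere f ->
  (m%:R^-1 * \sum_(j < m) f (p m j)) @[m --> \oo] --> (4 * pi)^-1 * sphere_integral f.
Proof.
move=> KM Koo pcell sf; have cg := continuous_on_sphere _ _ sf.
set g := f \o @spherical R in cg.
have [B B0 gB] := box_bounded _ cg.
apply/cvgrPdist_le => e e0.
have e4 : 0 < e / 4 by rewrite divr_gt0.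
have [d d0 gd] := uniform_on_box _ _ _ e4 cg.
(* The three terms make the cells narrower than [d] in colatitude and in longitude, and the
   incomplete round smaller than e/4. *)
pose k := (Num.truncn (64 / d ^+ 2 + 8 / d + 8 * B / e)).+1.
near=> m.
have Mm : (M <= m)%N by near: m; exact: nbhs_infty_ge.
have kK : (k <= K m)%N by near: m; exact: Koo.
have [K0 K4] := KM _ Mm; set L := K m in kK K0 K4.
have LR : 0 < L%:R :> R by rewrite ltr0n.
have Lk : 64 / d ^+ 2 + 8 / d + 8 * B / e <= L%:R.
  by rewrite ltW// (lt_le_trans (truncnS_gt _))// ler_nat.
have t1 : 0 <= 64 / d ^+ 2 by rewrite divr_ge0// sqr_ge0.
have t2 : 0 <= 8 / d by rewrite divr_ge0// ltW.
have t3 : 0 <= 8 * B / e by rewrite divr_ge0// ?mulr_ge0// ltW.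
have m0 : (0 < m)%N by apply: leq_trans K4; rewrite expn_gt0 K0.
have L20 : (0 < L ^ 2)%N by rewrite expn_gt0 K0.
have mR : 0 < m%:R :> R by rewrite ltr0n.
have close s z z' : in_cell R L s z -> in_cell R L s z' -> `|g z - g z'| <= e / 4.
  move=> iz iz'; have [h1 h2] := in_cell_close _ _ _ _ _ K0 iz iz'.
  apply: gd; first exact: in_cell_box iz.
    rewrite -(@ler_pXn2r _ 2)// ?nnegrE ?(ltW d0)// real_normK ?num_real//.
    apply: (le_trans h1); rewrite ler_pdivrMr// mulrC -ler_pdivrMr ?exprn_gt0//; lra.
  apply: (le_trans h2); rewrite ler_pdivrMr// mulrC -ler_pdivrMr//; lra.
pose c s := g (colat_cut L (band L s), longi_cut L (sector L s)).
have p0 : 0 < pi *+ 2 :> R by rewrite mulrn_wgt0// pi_gt0.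
have corner s : (s < L ^ 2)%N -> @in_cell R L s (colat_cut L (band L s), longi_cut L (sector L s)).
  move=> sL; apply: cell_in_cell => //; split; rewrite /= in_itv/= lexx/=.
    by apply: colat_cut_lt; exact: slot_band_lt.
  by rewrite /longi_cut ltr_pM2r ?invr_gt0// (ltr_pM2l p0) ltr_nat.
have int := integral_cell_approx L g c (e / 4) K0 cg (fun s z sL cz =>
  close s _ _ (cell_in_cell _ _ _ sL cz) (corner s sL)).
have cB s : (s < L ^ 2)%N -> `|c s| <= B.
  by move=> sL; apply: gB; exact: in_cell_box (corner s sL).
have in_cell_mod j z : in_cell R L j z -> in_cell R L (j %% L ^ 2) z.
  by rewrite /in_cell /band /sector modn_mod.
have avg := average_mod _ _ (L ^ 2) (fun j : 'I_m => f (p m j)) c (e / 4) B L20 m0.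
have {}avg := avg (fun j => ltac:(have [z cz ->] := pcell _ Mm j;
  exact: (close _ _ _ (in_cell_mod _ _ cz) (corner _ (ltn_pmod _ L20))))) cB.
have small : 2 * B * (L ^ 2)%:R / m%:R <= e / 4.
  rewrite ler_pdivrMr//.
  have : L%:R ^+ 4 <= m%:R :> R by rewrite -natrX ler_nat.
  have : 8 * B <= L%:R * e by rewrite -ler_pdivrMr//; lra.
  have L1 : 1 <= L%:R :> R by rewrite (ler_nat _ 1).
  rewrite natrX (_ : L%:R ^+ 4 = L%:R ^+ 2 * (L%:R * L%:R)); last by ring.
  move=> h1 h2.
  apply: (@le_trans _ _ (e / 4 * (L%:R ^+ 2 * (L%:R * L%:R)))); last by rewrite ler_pM2l.
  rewrite (_ : 2 * B * _ = L%:R ^+ 2 * (2 * B)); last by ring.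
  rewrite (_ : e / 4 * _ = L%:R ^+ 2 * (e / 4 * (L%:R * L%:R))); last by ring.
  by rewrite ler_pM2l ?exprn_gt0//; nra.
have pi0 : 0 < 4 * pi :> R by rewrite mulr_gt0// pi_gt0.
move: int; set S := \sum_(s < L ^ 2) c s in avg *; set I := \int[_]_(z in _) _ => int.
have int' : `|(4 * pi)^-1 * I - (L ^ 2)%:R^-1 * S| <= e / 4.
  rewrite -(ler_pM2l pi0) -{1}(gtr0_norm pi0) -normrM.
  have -> : 4 * pi * ((4 * pi)^-1 * I - (L ^ 2)%:R^-1 * S) = I - 4 * pi / L%:R ^+ 2 * S.
    by rewrite mulrBr mulVKf ?gt_eqF// natrX mulrA.
  exact: int.
have -> : sphere_integral f = I by [].
(* Both averages are compared with the average of the corner values; the three errors of e/4 are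
   those of the integral, of the points within their cells, and of the incomplete round. *)
rewrite (_ : _ - _ = ((4 * pi)^-1 * I - (L ^ 2)%:R^-1 * S) -
  (m%:R^-1 * \sum_(j < m) f (p m j) - (L ^ 2)%:R^-1 * S)); last by ring.
by rewrite (le_trans (ler_normB _ _))//; lra.
Unshelve. all: by end_near. Qed.

Section scale.
Context {R : realType}.

(* With K bands, K ^ 4 <= ln m makes [ln m / K ^ 2], the base of the exponential
   moments, at least the square root of [ln m]. *)
Definition nbands (m : nat) : nat :=
  \max_(k < m | expR (k%:R ^+ 4) <= m%:R :> R) k.

Lemma nbands_spec m : (0 < m)%N -> (nbands m)%:R ^+ 4 <= ln (m%:R : R).
Proof.
move=> m0; have mR : 0 < m%:R :> R by rewrite ltr0n.
rewrite /nbands; elim/big_ind : _ => [|x y hx hy|k hk].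
- by rewrite expr0n/= ln_ge0// (ler_nat _ 1).
- by rewrite /maxn; case: ifP.
- by rewrite -[leLHS]expRK ler_ln// posrE expR_gt0.
Qed.

Lemma nbands_ge k m : (k < m)%N -> expR (k%:R ^+ 4) <= m%:R :> R -> (k <= nbands m)%N.
Proof. by move=> km h; rewrite (leq_bigmax_cond (Ordinal km)). Qed.

Lemma nbands_near k : exists M, forall m, (M <= m)%N -> (k <= nbands m)%N.
Proof.
exists (k.+1 + (Num.truncn (expR (k%:R ^+ 4 : R))).+1)%N => m km.
apply: nbands_ge; first by exact: leq_trans (leq_addr _ _) km.
by rewrite ltW// (lt_le_trans (truncnS_gt _))// ler_nat (leq_trans (leq_addl _ _) km).
Qed.

End scale.

Theorem propositionA1 (R : realType) :
  exists c C : R, 0 < c /\ 0 < C /\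
  exists (M : nat) (p : forall m : nat, 'I_m -> 'rV[R]_3),
    (forall m, (M <= m)%N -> forall j, sphere (p m j)) /\
    (forall m, (M <= m)%N -> forall j k : 'I_m, j != k ->
       c / Num.sqrt m%:R <= gdist (p m j) (p m k)) /\
    (forall f : 'rV[R]_3 -> R, smooth_on_sphere f ->
       (m%:R^-1 * \sum_(j < m) f (p m j)) @[m --> \oo] -->
         (4 * pi)^-1 * sphere_integral f) /\
    (forall m, (M <= m)%N -> forall G : set 'rV[R]_3, great_circle G ->
       #|[pred j : 'I_m | p m j \in neighborhood m%:R^-1 G]|%:R <=
         C * ln m%:R / ln (ln m%:R)).
Proof.
exists 32^-1, (22 * 10 ^+ 3); split; first by rewrite invr_gt0.
split; first by rewrite mulr_gt0// exprn_gt0.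
have [M0 hM0] := @nbands_near R 100.
pose M := maxn M0 1.
have MK m : (M <= m)%N -> (100 <= @nbands R m)%N /\ (@nbands R m)%:R ^+ 4 <= ln (m%:R : R).
  by rewrite geq_max => /andP[h1 h2]; split; [exact: hM0|exact: nbands_spec].
(* The bound on [m] is put under the existential, with the zero family for small [m], so that one
   choice gives the whole family. *)
have config m : exists p, (M <= m)%N -> good_configuration R m (@nbands R m) p.
  have [Mm|Mm] := boolP (M <= m)%N; last by exists (fun=> 0).
  by have [h1 h2] := MK _ Mm; have [p hp] := exists_configuration _ _ _ h1 h2; exists p.
have [p hp] : exists p : forall m, 'I_m -> 'rV[R]_3,
    forall m, (M <= m)%N -> good_configuration R m (@nbands R m) (p m).
  by exists (fun m => sval (cid (config m))) => m; exact: svalP (cid (config m)).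
exists M, p; split; [|split; [|split]].
- by move=> m Mm j; have [/(_ j)[z _ ->] _ _] := hp m Mm; exact: spherical_sphere.
- by move=> m Mm; have [_ + _] := hp m Mm.
- move=> f sf; apply: (@equidistribution R M (@nbands R)) => //.
  + move=> m Mm; have [h1 h2] := MK _ Mm; split; first exact: leq_trans h1.
    rewrite -(ler_nat R) natrX (le_trans h2)//.
    have m0 : 0 < m%:R :> R by rewrite ltr0n; move: Mm; rewrite geq_max => /andP[].
    by have := expR_ge1Dx (ln (m%:R : R)); rewrite lnK ?posrE//; lra.
  + move=> k; have [N hN] := @nbands_near R k.
    by exists N => // m /= Nm; exact: hN.
  + by move=> m Mm j; have [/(_ j)] := hp m Mm.
- by move=> m Mm; have [_ _] := hp m Mm.
Qed.
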